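(* Let $X$ and $Y$ be $C^\infty$ vector fields on $\mathbb{R}^2$ with $X(0)=Y(0)=0$, each globally asymptotically stable at the origin. Let $\mathcal{Z}=\{p\in\mathbb{R}^2 : \det(X(p),Y(p))=0\}$. Assume that $\mathcal{Z}$ is compact. Then the switched system $$\dot q=u\,X(q)+(1-u)\,Y(q),\qquad q\in\mathbb{R}^2,\ u\in[0,1],$$ is bounded.
   Context: Switching functions are arbitrary measurable functions $u:[0,\infty)\to[0,1]$; let $\mathcal{U}$ be the set of all of them. For $p\in\mathbb{R}^2$ and $u\in\mathcal{U}$, let $t\mapsto\gamma(p,u,t)$ be the maximal solution of $\dot q(t)=u(t)X(q(t))+(1-u(t))Y(q(t))$ with $\gamma(p,u,0)=p$. The system is bounded if for every compact $K_1\subset\mathbb{R}^2$ there exists a compact $K_2\subset\mathbb{R}^2$ such that $\gamma(p,u,t)\in K_2$ for every $u\in\mathcal{U}$, every $t\ge 0$ and every $p\in K_1$ (in particular all these solutions are defined for all $t\geq 0$). A vector field is globally asymptotically stable at the origin if the origin is a Lyapunov stable equilibrium and all its integral curves converge to the origin as $t\to+\infty$. *)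

(* Defs.v *)
(* The plane is represented by row vectors in 'rV[R]_2 with R : realType. *)
From mathcomp Require Import all_boot all_order all_algebra.
From mathcomp Require Import all_classical all_reals all_analysis.
From mathcomp Require Import measurable_realfun.
Set Implicit Arguments.
Unset Strict Implicit.
Unset Printing Implicit Defensive.
Import Order.TTheory GRing.Theory Num.Theory.
Import numFieldNormedType.Exports.
Local Open Scope classical_set_scope.
Local Open Scope ring_scope.

(* R with its Lebesgue (not merely Borel) sigma-algebra. *)
Definition lebesgueR (R : realType) :=
  g_sigma_algebraType (completed_algebra_gen (@lebesgue_measure R)).

Section planar_switched_systems.
Context {R : realType}.
Local Notation plane := 'rV[R]_2.
Implicit Types (X Y f : plane -> plane) (g : R -> plane) (u : R -> R).

(* All iterated partial derivatives of order at most k exist and are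
   continuous on the whole plane. *)
Fixpoint Ck (k : nat) f : Prop :=
  continuous f /\
  if k is k'.+1 then
    forall i : 'I_2, (forall p, derivable f p (delta_mx 0 i)) /\
                     Ck k' (fun p => 'D_(delta_mx 0 i) f p)
  else True.

Definition smooth f : Prop := forall k, Ck k f.

Definition integral_curve X (a b : \bar R) g : Prop :=
  [/\ (a < 0)%E, (0 < b)%E &
      forall t : R, (a < t%:E)%E -> (t%:E < b)%E ->
        is_derive t (1 : R) g (X (g t))].

Definition maximal_integral_curve X (a b : \bar R) g : Prop :=
  integral_curve X a b g /\
  forall (a' b' : \bar R) (g' : R -> plane),
    (a' <= a)%E -> (b <= b')%E -> integral_curve X a' b' g' ->
    (forall t : R, (a < t%:E)%E -> (t%:E < b)%E -> g' t = g t) ->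
    a' = a /\ b' = b.

Definition lyapunov_stable X : Prop :=
  forall e : R, 0 < e -> exists2 d : R, 0 < d &
    forall (a b : \bar R) g, integral_curve X a b g -> `|g 0| < d ->
      forall t : R, 0 <= t -> (t%:E < b)%E -> `|g t| < e.

Definition globally_asymptotically_stable X : Prop :=
  [/\ X 0 = 0,
      lyapunov_stable X &
      forall (a b : \bar R) g, maximal_integral_curve X a b g ->
        b = +oo%E /\ g t @[t --> +oo] --> (0 : plane)].

(* The values of u on the negative half-line are irrelevant. *)
Definition switching_function u : Prop :=
  measurable_fun ([set t | 0 <= t] : set (lebesgueR R)) (u : lebesgueR R -> R) /\
  forall t, 0 <= t -> 0 <= u t <= 1.

Definition absolutely_continuous_on (a b : R) g : Prop :=
  forall e : R, 0 < e -> exists2 d : R, 0 < d &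
    forall (n : nat) (s t : 'I_n -> R),
      (forall i, [/\ a <= s i, s i <= t i & t i <= b]) ->
      trivIset setT (fun i => [set x : R | s i < x < t i]) ->
      \sum_(i < n) (t i - s i) < d ->
      \sum_(i < n) `|g (t i) - g (s i)| < e.

(* Since u is only measurable, solutions on [0, T[ are understood in the sense
   of Caratheodory: locally absolutely continuous, with the differential
   equation holding almost everywhere. *)
Definition switched_solution X Y u (p : plane) (T : \bar R) g : Prop :=
  [/\ (0 < T)%E,
      g 0 = p,
      (forall b : R, 0 < b -> (b%:E < T)%E -> absolutely_continuous_on 0 b g) &
      {ae (@lebesgue_measure R), forall t : R, 0 < t -> (t%:E < T)%E ->
        is_derive t (1 : R) g (u t *: X (g t) + (1 - u t) *: Y (g t))}].

Definition maximal_switched_solution X Y u (p : plane) (T : \bar R) g : Prop :=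
  switched_solution X Y u p T g /\
  forall (T' : \bar R) (g' : R -> plane),
    (T <= T')%E -> switched_solution X Y u p T' g' ->
    (forall t : R, 0 <= t -> (t%:E < T)%E -> g' t = g t) ->
    T' = T.

(* The trajectory gamma(p, u, .) is described relationally; the existence
   clause makes the universal clause non-vacuous. *)
Definition bounded_switched_system X Y : Prop :=
  forall K1 : set plane, compact K1 -> exists2 K2 : set plane, compact K2 &
    forall u, switching_function u -> forall p, K1 p ->
      (exists T g, maximal_switched_solution X Y u p T g) /\
      (forall T g, maximal_switched_solution X Y u p T g ->
         T = +oo%E /\ forall t : R, 0 <= t -> K2 (g t)).

Definition collinearity_set X Y : set plane :=
  [set p | \det (col_mx (X p) (Y p) : 'M[R]_2) = 0].

End planar_switched_systems.

(* Main.v *)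
Require Import Defs.
From mathcomp Require Import all_boot all_order all_algebra.
From mathcomp Require Import all_classical all_reals all_analysis.
From mathcomp Require Import measurable_realfun.
From mathcomp Require Import ring lra.
Import Order.TTheory GRing.Theory Num.Theory.
Import numFieldNormedType.Exports.
Local Open Scope classical_set_scope.
Local Open Scope ring_scope.
Set Implicit Arguments.
Unset Strict Implicit.
Unset Printing Implicit Defensive.

(** Why the system is bounded.  Fix [r] such that [X] and [Y] are linearly
independent outside the ball of radius [r].  Let a trajectory leave a large ball,
of radius [rho], for the last time at a time [t0], and let [p] be its position
then.  Consider the set [S] swept by the forward [X]-orbits of all the points of
the forward [Y]-orbit of [p], that is, the points [Phi_b (psi_a p)] for
[a, b >= 0], where [Phi] and [psi] are the flows of [X] and [Y].  By asymptotic
stability, orbits of either field issued from a ball stay in a larger ball and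
are trapped in the ball of radius [r] after a time that is uniform
([uniform_attraction]).  Hence [S] is contained in a ball which depends on [rho]
only, and the theorem follows if the trajectory cannot leave [S] after [t0]
([confinement]).

For this it suffices that [S] be tangent to all admissible velocities
[u X + (1 - u) Y] at each of its points [x = Phi_b y], [y = psi_a p], of norm
larger than [rho - 1], among which are the points nearest to the trajectory as
long as it is within distance [1] of [S]: the distance to [S] is then zero at
[t0] and has almost everywhere a Dini derivative at most proportional to itself
([trapped_gronwall]).  Increasing [b] moves [x] along [X], and increasing [a]
moves it along the vector [w] obtained by transporting [Y y] with the linearised
flow of [X].  If [rho - 1] bounds the [X]-orbits issued from the ball of radius
[r], then the [X]-arc from [y] to [x] avoids this ball, so that [(X, Y)] is a
frame all along it.  In this frame the equation of [w = mu X + nu Y] is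
triangular, and [nu], which starts from [1], solves a scalar linear equation and
stays positive ([transported_field]).  Therefore [u X + (1 - u) Y = be X + al w]
with [al = (1 - u) / nu >= 0], and with [be = u >= 0] on the edge [b = 0]: the
parameters [(a, b)] can be moved accordingly ([rectangle_tangent]).

The parameters may be restricted to a compact rectangle, whose far sides are
mapped into the set of the [X]-orbits issued from the ball of radius [r], which
the trajectory does not approach after [t0]; so nearest points in [S] exist
([nearest_in_rectangle]).

Solutions are taken in the sense of Caratheodory.  Monotonicity from a sign of a
derivative known almost everywhere is proved by covering the exceptional set by
an open set of small measure ([ae_dini_le0_nonincreasing],
[ae_derive_le_growth]).  Existence is obtained for truncated fields, which are
bounded and globally Lipschitz, by Picard iteration ([caratheodory_existence]);
confinement shows that the truncation is not felt, so that a global solution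
exists, and by uniqueness ([switched_solution_uniqueness]) every maximal solution
coincides with it. *)

(** * Growth controlled almost everywhere *)

Section almost_everywhere_calculus.
Context {R : realType}.
Local Notation mu := (@lebesgue_measure R).
Implicit Types (f m : R -> R) (a b : R).

(** Unlike [is_derive], this form hands over the increment estimate that all the
arguments below use. *)
Definition has_deriv (V : normedModType R) (g : R -> V) (t : R) (v : V) :=
  forall e, 0 < e -> exists2 d, 0 < d &
    forall s, `|s - t| < d -> `|g s - g t - (s - t) *: v| <= e * `|s - t|.

(** The upper right Dini derivative of [f] at [t] is at most [c]. *)
Definition right_dini_le f (t c : R) :=
  forall e, 0 < e -> exists2 d, 0 < d &
    forall s, t <= s -> s < t + d -> f s - f t <= (c + e) * (s - t).

Definition lipschitz_between (V : normedModType R) (K a b : R) (g : R -> V) :=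
  forall s t, a <= s -> s <= t -> t <= b -> `|g t - g s| <= K * (t - s).

(** A supremum argument packaged as an induction on a segment. *)
Lemma real_induction a b (P : R -> Prop) : P a ->
  (forall t, a <= t < b -> P t ->
     exists2 d, 0 < d & forall y, t < y < t + d -> y <= b -> P y) ->
  (forall t, a < t <= b -> (forall x, a <= x < t -> P x) -> P t) ->
  forall t, a <= t <= b -> P t.
Proof.
move=> Pa right left t /andP[at_ tb].
pose S := [set x | a <= x <= b /\ forall y, a <= y <= x -> P y].
have ab := le_trans at_ tb.
have Sa : S a.
  split; first by rewrite lexx.
  by move=> y; rewrite -eq_le => /eqP <-.
have supS : has_sup S.
  by split; [exists a | exists b => x [/andP[]]].
have aS : a <= sup S by apply: ub_le_sup => //; case: supS.
have Sb : sup S <= b by apply: ge_sup; [exists a | move=> x [/andP[]]].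
have below x : a <= x < sup S -> P x.
  move=> /andP[ax xS].
  have [y Sy xy] := sup_adherent (eps := sup S - x) ltac:(by rewrite subr_gt0) supS.
  apply: (Sy.2 x); rewrite ax /=; apply/ltW.
  by move: xy; rewrite opprB addrC subrK.
have PS : P (sup S).
  move: aS; rewrite le_eqVlt => /orP[/eqP <- //|aS].
  by apply: left => //; rewrite aS.
have [Sb'|bS] := ltP (sup S) b; last first.
  have [tS|St] := ltP t (sup S); first by apply: below; rewrite at_.
  suff -> : t = sup S by [].
  by apply/le_anti; rewrite St andbT (le_trans tb).
have [d d0 Pd] := right (sup S) ltac:(by rewrite aS) PS.
exfalso.
pose z := Num.min b (sup S + d / 2).
have zS : sup S < z by rewrite lt_min Sb' ltrDl divr_gt0.
suff Sz : S z by move: zS; rewrite ltNge ub_le_sup //; case: supS.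
split; first by rewrite (le_trans aS (ltW zS)) ge_min lexx.
move=> y /andP[ay yz].
have [yS|] := ltP y (sup S); first by apply: below; rewrite ay.
rewrite le_eqVlt => /orP[/eqP <- //|Sy]; apply: Pd.
  rewrite Sy (le_lt_trans yz) // gt_min; apply/orP; right.
  by rewrite ltrD2l ltr_pdivrMr // ltr_pMr // ltr1n.
by rewrite (le_trans yz) // ge_min lexx.
Qed.

(** The monotone function [m] pays for the growth of [f] at the points where
nothing is known about its derivative. *)
Lemma growth_le_control a b f m : a <= b ->
  (forall t, a < t <= b -> forall e, 0 < e -> exists2 d, 0 < d &
     forall x, a <= x -> x <= t -> t - d < x -> f t - f x <= e) ->
  {in `[a, b] &, {homo m : x y / x <= y}} ->
  (forall t, a <= t < b -> right_dini_le f t 0 \/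
     exists2 d, 0 < d & forall y, t < y < t + d -> y <= b ->
       f y - f t <= m y - m t) ->
  f b - f a <= m b - m a.
Proof.
move=> ab cf mm H.
apply/ler_addgt0Pr => e e0.
pose c := e / (b - a + 1).
have ba1 : 0 < b - a + 1 by rewrite ltr_wpDl // subr_ge0.
have c0 : 0 < c by rewrite divr_gt0.
suff Hc : f b - f a <= m b - m a + c * (b - a).
  apply: (le_trans Hc); rewrite lerD2l /c mulrAC ler_pdivrMr // ler_pM2l //.
  by rewrite lerDl.
pose P x := f x - f a <= m x - m a + c * (x - a).
apply: (@real_induction a b P) => //; last by rewrite ab lexx.
- by rewrite /P !subrr mulr0 addr0.
- move=> t /andP[at_ tb] Pt; case: (H t); first by rewrite at_.
  + move=> /(_ c c0) [d d0 Hd]; exists d => // y /andP[ty yd] yb.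
    have := Hd y (ltW ty) yd; rewrite add0r.
    have := mm t y; rewrite !in_itv /= at_ (ltW tb) yb (le_trans at_ (ltW ty)).
    move=> /(_ isT isT (ltW ty)) mty.
    move: Pt; rewrite /P; nra.
  + move=> [d d0 Hd]; exists d => // y ty yb.
    have := Hd y ty yb; case/andP: ty => ty _; move: Pt; rewrite /P.
    by have : 0 < c * (y - t) by [rewrite mulr_gt0 // subr_gt0]; lra.
- move=> t /andP[at_ tb] Pt; rewrite /P; apply/ler_addgt0Pr => e' e'0.
  have [d d0 Hd] := cf t ltac:(by rewrite at_) e' e'0.
  pose x := Num.max a (t - d / 2).
  have xt : x < t by rewrite gt_max at_ /= ltrBlDr ltrDl divr_gt0.
  have ax : a <= x by rewrite le_max lexx.
  have := Pt x ltac:(by rewrite ax); rewrite /P.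
  have := Hd x ax (ltW xt).
  have -> : t - d < x.
    by rewrite lt_max; apply/orP; right; rewrite ltrD2l ltrN2; lra.
  move=> /(_ isT).
  have := mm x t; rewrite !in_itv /= ax (ltW at_) tb (le_trans (ltW xt) tb).
  move=> /(_ isT isT (ltW xt)).
  have : 0 < c * (t - x) by rewrite mulr_gt0 // subr_gt0.
  lra.
Qed.
(** The control is the measure of the part of a small open neighbourhood [U] of
[N] lying on the left of the point: it is monotone, small, and grows at unit
speed inside [U]. *)
Lemma negligible_control (N : set R) (e : R) : mu.-negligible N -> 0 < e ->
  exists U m, [/\ open U, N `<=` U, {homo m : x y / x <= y},
    forall x, 0 <= m x <= e &
    forall x y, x <= y -> `]x, y] `<=` U -> y - x <= m y - m x].
Proof.
move=> [A [mA A0 NA]] e0.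
have Afin : (lebesgue_measure A < +oo)%E.
  by apply: (@le_lt_trans _ _ 0%E); [rewrite -A0 | rewrite ltry].
have [U [oU AU UA]] := lebesgue_regularity_outer mA Afin e0.
have mU : measurable U by exact: open_measurable.
have Ue : (mu U <= e%:E)%E.
  apply: (@le_trans _ _ (mu ((U `\` A) `|` A))).
    apply: le_measure; rewrite ?inE //.
      by apply: measurableU => //; exact: measurableD.
    by move=> x Ux; have [Ax|nAx] := pselect (A x); [right|left].
  apply: (le_trans (measureU2 _ _ _)) => //; first exact: measurableD.
  rewrite -[leRHS]adde0; apply: leeD; first exact: ltW.
  by rewrite le_eqVlt; apply/orP; left; apply/eqP; exact: A0.
pose B x := U `&` `]-oo, x].
have mB x : measurable (B x).
  by apply: measurableI => //; exact: measurable_itv.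
have BU x : (mu (B x) <= mu U)%E.
  by apply: le_measure; [apply/mem_set; exact: mB | exact/mem_set | exact: subIsetl].
have Bfin x : mu (B x) \is a fin_num.
  by rewrite ge0_fin_numE // (le_lt_trans (le_trans (BU x) Ue)) ?ltry.
exists U, (fun x => fine (mu (B x))); split => //.
- by move=> x /NA /AU.
- move=> x y xy; apply: fine_le => //; apply: le_measure; [apply/mem_set; exact: mB..|].
  apply: setIS => z /=; rewrite !in_itv /= => /le_trans; exact.
- move=> x; rewrite fine_ge0 //= -lee_fin fineK //.
  exact: le_trans (BU x) Ue.
- move=> x y xy xyU.
  have -> : B y = B x `|` `]x, y].
    rewrite /B; apply/seteqP; split=> z /=.
      move=> [Uz]; rewrite !in_itv /= => zy.
      by have [zx|xz] := leP z x; [left; split | right; rewrite ?xz].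
    move=> [[Uz]|].
      by rewrite !in_itv /= => zx; split => //; exact: le_trans zx xy.
    rewrite !in_itv /= => /andP[xz zy]; split => //.
    by apply: xyU; rewrite /= in_itv /= xz.
  have muI : mu `]x, y] = (y - x)%:E.
    rewrite lebesgue_measure_itv /= lte_fin.
    by case: ltgtP xy => //= -> _; rewrite subrr.
  have -> : mu (B x `|` `]x, y]) = (mu (B x) + (y - x)%:E)%E.
    rewrite -muI; apply: measureU; [exact: mB | exact: measurable_itv |].
    rewrite /B; apply/seteqP; split=> z //= [[_]].
    by rewrite /= !in_itv /= => zx /andP[]; rewrite ltNge zx.
  by rewrite fineD //= addrAC subrr add0r.
Qed.

(** The exceptional set is covered by an open set [U] of small measure; while
[t] runs through [U] the growth of [f] is charged to the length of [U] by the
Lipschitz bound, and elsewhere the Dini derivative controls it. *)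
Lemma ae_dini_le0_nonincreasing (N : set R) (K a b : R) f : a <= b ->
  lipschitz_between K a b f -> mu.-negligible N ->
  (forall t, a <= t < b -> ~ N t -> right_dini_le f t 0) -> f b <= f a.
Proof.
move=> ab fK N0 Hf.
wlog K0 : K fK / 0 < K.
  move=> /(_ (Num.max K 1)); apply; last by rewrite lt_max ltr01 orbT.
  move=> s t a_s st tb; apply: (le_trans (fK s t a_s st tb)).
  by apply: ler_wpM2r; [rewrite subr_ge0|rewrite le_max lexx].
rewrite -subr_le0; apply/ler_addgt0Pr => e e0; rewrite add0r.
have [U [m [oU NU mm m01 mU]]] := negligible_control N0 (e := e / K)
  ltac:(by rewrite divr_gt0).
have fab : f b - f a <= K * m b - K * m a.
  apply: (@growth_le_control a b f (fun x => K * m x)) => //.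
  - move=> t /andP[at_ tb] e' e'0; exists (e' / K); first by rewrite divr_gt0.
    move=> x ax xt tx; apply: (le_trans (ler_norm _)).
    apply: (le_trans (fK x t ax xt tb)).
    by rewrite mulrC -ler_pdivlMr //; lra.
  - by move=> x y _ _ xy; rewrite ler_pM2l // mm.
  - move=> t /andP[at_ tb].
    have [Nt|nNt] := pselect (N t); last first.
      by left; apply: Hf => //; rewrite at_.
    right; have := open_nbhs_nbhs (conj oU (NU _ Nt)).
    move=> /nbhs_ballP[d d0 Hd]; exists d => // y /andP[ty yd] yb.
    apply: (le_trans (ler_norm _)); apply: (le_trans (fK t y at_ (ltW ty) yb)).
    rewrite -mulrBr ler_pM2l //; apply: mU; first exact: ltW.
    move=> z /=; rewrite in_itv /= => /andP[tz zy]; apply: Hd.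
    by rewrite /ball /= distrC gtr0_norm ?subr_gt0 //; lra.
apply: (le_trans fab); rewrite -mulrBr mulrC -ler_pdivlMr //.
by have := m01 b; have := m01 a; lra.
Qed.

(** Vector-valued, so as to apply to a trajectory and to its coordinates alike. *)
Definition absolutely_continuous_between (V : normedModType R) a b (g : R -> V) :=
  forall e : R, 0 < e -> exists2 d : R, 0 < d &
    forall (n : nat) (s t : 'I_n -> R),
      (forall i, [/\ a <= s i, s i <= t i & t i <= b]) ->
      trivIset setT (fun i => [set x : R | s i < x < t i]) ->
      \sum_(i < n) (t i - s i) < d ->
      \sum_(i < n) `|g (t i) - g (s i)| < e.

(** As for [ae_dini_le0_nonincreasing], but without a Lipschitz bound the growth
of [f] on the open neighbourhood of the exceptional set is estimated by
absolute continuity, over the list of intervals met so far. *)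
Lemma ae_derive_le_growth (N : set R) (K a b : R) f : a <= b -> 0 <= K ->
  absolutely_continuous_between a b f -> mu.-negligible N ->
  (forall t, a < t < b -> ~ N t -> exists2 c, c <= K & has_deriv f t c) ->
  f b - f a <= K * (b - a).
Proof.
move=> ab K0 fAC N0 Hf; apply/ler_addgt0Pr => e' e'0.
pose e := e' / 2; have e0 : 0 < e by rewrite divr_gt0.
have [d0 d00 Hd0] := fAC e e0.
have N0' : mu.-negligible (N `|` [set a; b]).
  apply: negligibleU => //; apply/negligibleP => //=.
    exact: measurableU.
  apply: countable_lebesgue_measure0; apply: finite_set_countable.
  exact: finite_set2.
have [U [m [oU NU mm m01 mU]]] := negligible_control N0' (e := d0 / 2)
  ltac:(by rewrite divr_gt0).
pose ba1 := b - a + 1.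
have ba10 : 0 < ba1 by rewrite ltr_wpDl // subr_ge0.
pose c := e / ba1; have c0 : 0 < c by rewrite divr_gt0.
(* [fam x l]: [l] lists, from right to left, disjoint subintervals of [a, x]
   contained in [U]; absolute continuity bounds the variation of [f] over them. *)
pose fam x (l : seq (R * R)) := [/\ forall p, p \in l -> [/\ a <= p.1, p.1 <= p.2 & p.2 <= x],
  pairwise (fun p q : R * R => q.2 <= p.1) l &
  \sum_(p <- l) (p.2 - p.1) <= m x - m a].
pose P x := exists2 l, fam x l &
  f x - f a <= (K + c) * (x - a) + \sum_(p <- l) `|f p.2 - f p.1|.
have short x l : fam x l -> x <= b -> \sum_(p <- l) `|f p.2 - f p.1| < e.
  move=> [Hl pw suml] xb; rewrite (big_nth (a, a)) big_mkord.
  apply: (Hd0 _ (fun i => (nth (a, a) l i).1) (fun i => (nth (a, a) l i).2)).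
  - move=> i; have [] := Hl (nth (a, a) l i) (mem_nth _ (ltn_ord i)).
    by move=> *; split => //; apply: le_trans xb.
  - have dis i j z : (i < size l)%N -> (j < size l)%N -> (i < j)%N ->
        (nth (a, a) l i).1 < z -> z < (nth (a, a) l j).2 -> False.
      move=> il jl ij /= h1 h2; move/(pairwiseP (a, a)): pw.
      move=> /(_ i j il jl ij); move: h1 h2; lra.
    move=> i j _ _ [z /= [/andP[h1 h2] /andP[h3 h4]]]; apply/val_inj => /=.
    by case: (ltngtP i j) => // ij; [case: (dis i j z) | case: (dis j i z)].
  - have := suml; rewrite (big_nth (a, a)) big_mkord => /le_lt_trans; apply.
    by have := m01 x; have := m01 a; lra.
(* Either [t] lies in [U] and a small interval around it joins the list, or [f]
   has a derivative at [t] and grows with slope at most [K + c] across [t]. *)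
have step t : a <= t <= b -> exists2 d, 0 < d & forall x y, a <= x -> x <= t -> t <= y ->
    y <= b -> t - d < x -> y < t + d -> P x -> P y.
  move=> /andP[at_ tb]; have [Nt|nNt] := pselect ((N `|` [set a; b]) t).
    have := open_nbhs_nbhs (conj oU (NU _ Nt)).
    move=> /nbhs_ballP[d dd0 Hd]; exists d => // x y ax xt ty yb xd yd.
    move=> [l [Hl pw suml] Pl]; exists ((x, y) :: l); first split.
    + move=> p; rewrite in_cons => /orP[/eqP -> /=|/Hl [h1 h2 h3]]; split => //; lra.
    + by rewrite pairwise_cons pw andbT; apply/allP => q /Hl[].
    + rewrite big_cons /=.
      suff /(mU x y (le_trans xt ty)) : `]x, y] `<=` U by move: suml; lra.
      move=> z; rewrite /= in_itv /= => /andP[xz zy]; apply: Hd.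
      by rewrite /ball /= ltr_norml; lra.
    + rewrite big_cons /=; have := ler_norm (f y - f x); move: Pl.
      have : 0 <= (K + c) * (y - x) by rewrite mulr_ge0 //; lra.
      lra.
  have at' : a < t.
    by rewrite lt_neqAle at_ andbT; apply/eqP => h; apply: nNt; right; left.
  have tb' : t < b.
    by rewrite lt_neqAle tb andbT; apply/eqP => h; apply: nNt; right; right.
  have [k kK /(_ c c0) [d dd0 Hd]] := Hf t ltac:(by rewrite at') (fun h => nNt (or_introl h)).
  exists d => // x y ax xt ty yb xd yd [l [Hl pw suml] Pl]; exists l.
    split => //; first by move=> p /Hl[*]; split => //; lra.
    have := mm x y (le_trans xt ty); lra.
  have := Hd x; have := Hd y; rewrite !ler_norml !ltr_norml.
  rewrite (ger0_norm (x := y - t)) ?subr_ge0 // (ler0_norm (x := x - t)) ?subr_le0 //.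
  move=> /(_ ltac:(lra)) /andP[_ h1] /(_ ltac:(lra)) /andP[h2 _].
  have : k * (y - x) <= K * (y - x) by apply: ler_wpM2r => //; lra.
  have e1 : (y - t) *: (k : R^o) = k * (y - t) by rewrite mulrC.
  have e2 : (x - t) *: (k : R^o) = k * (x - t) by rewrite mulrC.
  move: h1 h2 Pl; rewrite e1 e2; lra.
have Pb : P b.
  apply: (@real_induction a b P); last by rewrite ab lexx.
  - exists [::]; first by split => //; rewrite big_nil subrr.
    by rewrite big_nil !subrr mulr0 addr0.
  - move=> t /andP[at_ tb] Pt; have [|d dd0 Hd] := step t; first by rewrite at_ ltW.
    exists d => // y /andP[ty yd] yb; apply: (Hd t y) => //; [exact: ltW | lra].
  - move=> t /andP[at_ tb] Pt; have [|d dd0 Hd] := step t; first by rewrite tb ltW.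
    pose x := Num.max a (t - d / 2).
    have xt : x < t by rewrite gt_max at_ /= ltrBlDr ltrDl divr_gt0.
    have ax : a <= x by rewrite le_max lexx.
    apply: (Hd x t) => //; try lra; [|by apply: Pt; rewrite ax].
    by rewrite lt_max; apply/orP; right; lra.
have [l fl Pl] := Pb; have := short b l fl (lexx b).
have cb : c * (b - a) <= e.
  by rewrite /c mulrAC ler_pdivrMr // ler_pM2l // /ba1 lerDl.
move: Pl; rewrite mulrDl /e in cb *; lra.
Qed.
End almost_everywhere_calculus.

(** * Derivatives of curves and Gronwall inequalities *)

Section vector_calculus.
Context {R : realType}.
Local Notation mu := (@lebesgue_measure R).
Local Notation plane := 'rV[R]_2.

Lemma is_deriveP (V : normedModType R) (g : R -> V) t v :
  is_derive t (1 : R) g v <-> has_deriv g t v.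
Proof.
split=> [[dg gv] e e0|H].
  have /cvgrPdist_le/(_ e e0) : h^-1 *: ((g \o shift t) (h *: (1 : R)) - g t) @[h --> 0^'] --> v.
    by rewrite -gv; exact: dg.
  move=> [d /= d0 Hd]; exists d => // s sd.
  have [->|st] := eqVneq s t; first by rewrite !subrr scale0r subrr !normr0 mulr0.
  have st0 : s - t != 0 by rewrite subr_eq0.
  have := Hd (s - t); rewrite /ball /= sub0r normrN => /(_ sd st0).
  rewrite /shift /= [_ *: 1]mulr1 subrK => He.
  rewrite -[g s - g t](scalerKV st0) -scalerBr normrZ mulrC ler_wpM2r //.
  by rewrite distrC.
have C : h^-1 *: ((g \o shift t) (h *: (1 : R)) - g t) @[h --> 0^'] --> v.
  apply/cvgrPdist_le => e e0; have [d d0 Hd] := H e e0.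
  exists d => //= h; rewrite /ball /= sub0r normrN => hd h0.
  rewrite /shift /= [_ *: 1]mulr1 distrC.
  have := Hd (h + t); rewrite addrK => /(_ hd).
  have {1}-> : g (h + t) - g t - h *: v = h *: (h^-1 *: (g (h + t) - g t) - v).
    by rewrite scalerBr scalerA divff // scale1r.
  by rewrite normrZ mulrC ler_pM2r // normr_gt0.
by split; [apply/cvg_ex; exists v | exact/cvg_lim].
Qed.

Lemma row_norm_le n (x : 'rV[R]_n) (e : R) : 0 <= e ->
  (`|x| <= e) <-> (forall i, `|x 0 i| <= e).
Proof.
move=> e0; rewrite /Num.Def.normr /= mx_normrE; split.
  by move=> /bigmax_leP[_ H] i; exact: (H (0, i)).
move=> H; apply/bigmax_leP; split => // -[i j] _ /=.
by rewrite (ord1 i); exact: H.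
Qed.

Lemma coord_norm_le n (x : 'rV[R]_n) i : `|x 0 i| <= `|x|.
Proof. by move: i; apply/row_norm_le. Qed.

Lemma has_deriv_coord n (g : R -> 'rV[R]_n) t v i :
  has_deriv g t v -> has_deriv (fun s => g s 0 i) t (v 0 i : R).
Proof.
move=> H e e0; have [d d0 Hd] := H e e0; exists d => // s sd.
apply: le_trans (Hd s sd).
by have := coord_norm_le (g s - g t - (s - t) *: v) i; rewrite !mxE.
Qed.

Lemma has_derivN (V : normedModType R) (g : R -> V) t v :
  has_deriv g t v -> has_deriv (fun s => - g s) t (- v).
Proof. by move=> /is_deriveP H; apply/is_deriveP; exact: is_deriveN. Qed.

Lemma has_derivB (V : normedModType R) (g h : R -> V) t v w :
  has_deriv g t v -> has_deriv h t w -> has_deriv (fun s => g s - h s) t (v - w).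
Proof. by move=> /is_deriveP H /is_deriveP K; apply/is_deriveP; exact: is_deriveB. Qed.

Lemma has_derivD (V : normedModType R) (g h : R -> V) t v w :
  has_deriv g t v -> has_deriv h t w -> has_deriv (fun s => g s + h s) t (v + w).
Proof. by move=> /is_deriveP H /is_deriveP K; apply/is_deriveP; exact: is_deriveD. Qed.

Lemma has_deriv_continuous (V : normedModType R) (g : R -> V) t v :
  has_deriv g t v -> {for t, continuous g}.
Proof.
by move=> /is_deriveP[/derivable1_diffP dg _]; exact: differentiable_continuous.
Qed.

Lemma everywhere_derive_le_growth (K : R) a b (f : R -> R) : a <= b -> 0 <= K ->
  (forall t, a <= t <= b -> exists2 c : R, c <= K & has_deriv f t c) ->
  f b - f a <= K * (b - a).
Proof.
move=> ab K0 Hf; suff : (f b - K * b) - (f a - K * a) <= 0 - 0 by lra.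
apply: (@growth_le_control R a b (fun x => f x - K * x) (fun=> 0) ab).
- move=> x /andP[ax xb] e e0.
  have [|c cK Hc] := Hf x; first by apply/andP; split; lra.
  have /cvgrPdist_le/(_ e e0)[d /= d0 Hd] := has_deriv_continuous Hc.
  exists d => // y sy yx xdy.
  have : f x - f y <= e.
    apply: (le_trans (ler_norm _)); apply: Hd; rewrite /ball /= ger0_norm; lra.
  have : K * y <= K * x by exact: ler_wpM2l.
  lra.
- by [].
- move=> x /andP[sx xt]; left => e e0.
  have [|c cK Hc] := Hf x; first by apply/andP; split; lra.
  have [d d0 Hd] := Hc e e0; exists d => // y xy yd.
  have := Hd y; rewrite ger0_norm ?subr_ge0 // => /(_ ltac:(lra)).
  rewrite ler_norml => /andP[_].
  have -> : (y - x) *: (c : R^o) = c * (y - x) by rewrite mulrC.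
  have : c * (y - x) <= K * (y - x) by apply: ler_wpM2r; lra.
  lra.
Qed.

Lemma everywhere_derive_bounded_lipschitz (K : R) a b n (g : R -> 'rV[R]_n) :
  0 <= K -> (forall t, a <= t <= b -> exists2 v, `|v| <= K & has_deriv g t v) ->
  lipschitz_between K a b g.
Proof.
move=> K0 H s t a_s st tb.
have {}H x : s <= x <= t -> exists2 v, `|v| <= K & has_deriv g x v.
  by move=> /andP[sx xt]; apply: H; apply/andP; split; lra.
apply/row_norm_le; first by rewrite mulr_ge0 // subr_ge0.
move=> i; rewrite !mxE ler_norml; apply/andP; split; last first.
  apply: (@everywhere_derive_le_growth K s t (fun x => g x 0 i)) => // x /H [v vK Hv].
  exists (v 0 i); last exact: has_deriv_coord.
  exact: le_trans (ler_norm _) (le_trans (coord_norm_le _ _) vK).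
suff : - g t 0 i - (- g s 0 i) <= K * (t - s) by lra.
apply: (@everywhere_derive_le_growth K s t (fun x => - g x 0 i)) => // x /H [v vK Hv].
exists (- v 0 i); last exact/has_derivN/has_deriv_coord.
rewrite (le_trans (ler_norm _)) // normrN.
exact: (le_trans (coord_norm_le _ _) vK).
Qed.

(** This turns trajectories, which are only assumed absolutely continuous, into
Lipschitz curves as soon as their velocity is bounded; everything afterwards is
done with Lipschitz curves. *)
Lemma ae_derive_bounded_lipschitz (N : set R) (K a b : R) n (g : R -> 'rV[R]_n) :
  0 <= K -> absolutely_continuous_between a b g -> mu.-negligible N ->
  (forall t, a < t < b -> ~ N t -> exists2 v, `|v| <= K & has_deriv g t v) ->
  lipschitz_between K a b g.
Proof.
move=> K0 gAC N0 H s t a_s st tb.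
have G (f : R -> R) : absolutely_continuous_between a b f ->
    (forall x, a < x < b -> ~ N x -> exists2 c : R, c <= K & has_deriv f x c) ->
    f t - f s <= K * (t - s).
  move=> fAC Hf; apply: (@ae_derive_le_growth R N) => //.
  - move=> e /fAC[d d0 Hd]; exists d => // k u w Huw; apply: Hd => i.
    by case: (Huw i) => *; split => //; [exact: le_trans a_s _|exact: le_trans tb].
  - by move=> x /andP[sx xt]; apply: Hf; rewrite (le_lt_trans a_s sx) (lt_le_trans xt).
have AC i : absolutely_continuous_between a b (fun x => g x 0 i).
  move=> e /gAC[d d0 Hd]; exists d => // k u w Huw tr uw.
  apply: le_lt_trans (Hd k u w Huw tr uw); apply: ler_sum => j _.
  by have := coord_norm_le (g (w j) - g (u j)) i; rewrite !mxE.
apply/row_norm_le; first by rewrite mulr_ge0 // subr_ge0.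
move=> i; rewrite !mxE ler_norml; apply/andP; split; last first.
  apply: (G (fun x => g x 0 i)) => // x xab /(H x xab)[v vK Hv]; exists (v 0 i).
    exact: le_trans (ler_norm _) (le_trans (coord_norm_le _ _) vK).
  exact: has_deriv_coord.
suff : - g t 0 i - (- g s 0 i) <= K * (t - s) by lra.
apply: (G (fun x => - g x 0 i)).
  move=> e /(AC i)[d d0 Hd]; exists d => // k u w Huw tr uw.
  apply: le_lt_trans (Hd k u w Huw tr uw); apply: ler_sum => j _.
  by rewrite -opprD normrN.
move=> x xab /(H x xab)[v vK Hv]; exists (- v 0 i).
  rewrite (le_trans (ler_norm _)) // normrN.
  exact: (le_trans (coord_norm_le _ _) vK).
exact/has_derivN/has_deriv_coord.
Qed.

(** The usual integrating factor: [exp (- L (t - a)) f t - c (t - a)] has a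
nonpositive Dini derivative almost everywhere. *)
Lemma gronwall_dini (N : set R) (K L c a b : R) (f : R -> R) : a <= b ->
  0 <= L -> 0 <= c -> (forall t, a <= t <= b -> 0 <= f t) ->
  lipschitz_between K a b f -> mu.-negligible N ->
  (forall t, a < t < b -> ~ N t -> right_dini_le f t (L * f t + c)) ->
  f b <= (f a + c * (b - a)) * expR (L * (b - a)).
Proof.
move=> ab L0 c0 f0 fK N0 Hf.
wlog K0 : K fK / 0 <= K.
  move=> /(_ (Num.max K 0)); apply; last by rewrite le_max lexx orbT.
  move=> s t a_s st tb; apply: (le_trans (fK s t a_s st tb)).
  by apply: ler_wpM2r; [rewrite subr_ge0|rewrite le_max lexx].
pose E t := expR (- (L * (t - a))).
have E1 t : a <= t -> E t <= 1.
  by move=> at_; rewrite -expR0 ler_expR oppr_le0 mulr_ge0 // subr_ge0.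
have E0 t : 0 < E t by exact: expR_gt0.
have EM s t : E s = E t * expR (- (L * (s - t))).
  by rewrite /E -expRD; congr expR; ring.
pose F t := E t * f t - c * (t - a).
have fB t : a <= t -> t <= b -> f t <= f a + K * (b - a).
  move=> at_ tb; have := le_trans (ler_norm _) (fK a t (lexx a) at_ tb).
  have : K * (t - a) <= K * (b - a) by apply: ler_wpM2l; lra.
  lra.
set B := f a + K * (b - a) in fB.
have N0' : mu.-negligible (N `|` [set a]).
  by apply: negligibleU => //; apply/negligibleP => //=; exact: lebesgue_measure_set1.
have FL : lipschitz_between (K + B * L + c) a b F.
  move=> s t a_s st tb; rewrite /F.
  have -> : E t * f t - c * (t - a) - (E s * f s - c * (s - a)) =
    E t * (f t - f s) + f s * (E t - E s) - c * (t - s) by ring.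
  have at_ := le_trans a_s st; have sb := le_trans st tb.
  apply: (le_trans (ler_normB _ _)); rewrite (mulrDl _ c) (mulrDl K) lerD //; last first.
    by rewrite ger0_norm // mulr_ge0 // subr_ge0.
  apply: (le_trans (ler_normD _ _)); apply: lerD; rewrite normrM.
    rewrite -[leRHS]mul1r ler_pM //; last exact: fK.
    by rewrite gtr0_norm // E1.
  rewrite -[leRHS]mulrA; apply: ler_pM => //.
    by rewrite ger0_norm ?fB // f0 // a_s.
  rewrite (EM t s) -{2}[E s]mulr1 -mulrBr normrM gtr0_norm //.
  rewrite -[leRHS]mul1r; apply: ler_pM => //; [exact: ltW | exact: E1 |].
  have x0 : 0 <= L * (t - s) by rewrite mulr_ge0 // subr_ge0.
  rewrite distrC ger0_norm.
    by have := expR_ge1Dx (- (L * (t - s))); lra.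
  by rewrite subr_ge0 -expR0 ler_expR oppr_le0.
have : F b <= F a.
  apply: (ae_dini_le0_nonincreasing ab FL N0') => t /andP[at_ tb] nNt.
  have at' : a < t.
    by rewrite lt_neqAle at_ andbT; apply/eqP => h; apply: nNt; right.
  move=> e e0.
  have [d d0 Hd] := Hf t ltac:(by rewrite at' tb) (fun h => nNt (or_introl h)) e e0.
  exists d => // s ts sd; have := Hd s ts sd; rewrite /F add0r => h.
  have f0t : 0 <= f t by rewrite f0 // at_ ltW.
  (* Convexity of the exponential replaces the derivative of [E]. *)
  have Es : E t >= E s * (1 + L * (s - t)).
    rewrite (EM t s) ler_pM2l //; have := expR_ge1Dx (L * (s - t)).
    by congr (_ <= expR _); ring.
  have h1 : E s * (f s - f t) <= E s * ((L * f t + c + e) * (s - t)).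
    by rewrite ler_pM2l.
  have h2 : f t * (E s * (1 + L * (s - t))) <= f t * E t by exact: ler_wpM2l.
  have h3 : E s * ((c + e) * (s - t)) <= (c + e) * (s - t).
    rewrite -[leRHS]mul1r ler_wpM2r // ?E1 ?(le_trans at_) // mulr_ge0; lra.
  lra.
rewrite /F subrr mulr0 subr0 {2}/E subrr mulr0 oppr0 expR0 mul1r => h.
have {}h : E b * f b <= f a + c * (b - a) by lra.
rewrite -ler_pdivrMr ?expR_gt0 //; apply: le_trans h.
by rewrite mulrC /E expRN.
Qed.

Lemma has_deriv_norm_dini (V : normedModType R) (h : R -> V) t v c :
  has_deriv h t v -> `|v| <= c -> right_dini_le (fun s => `|h s|) t c.
Proof.
move=> H vc e e0; have [d d0 Hd] := H e e0; exists d => // s ts sd.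
have := Hd s; rewrite ger0_norm ?subr_ge0 // => /(_ ltac:(lra)) Hs.
have -> : h s = (h s - h t - (s - t) *: v) + (h t + (s - t) *: v).
  by rewrite addrACA addNr addr0 subrK.
have h1 := ler_normD (h s - h t - (s - t) *: v) (h t + (s - t) *: v).
have h2 := ler_normD (h t) ((s - t) *: v).
have h3 : `|(s - t) *: v| <= c * (s - t).
  by rewrite normrZ ger0_norm ?subr_ge0 // mulrC ler_wpM2r // subr_ge0.
lra.
Qed.

Lemma lipschitz_between_norm (V : normedModType R) (K a b : R) (h : R -> V) :
  lipschitz_between K a b h -> lipschitz_between K a b (fun s => `|h s|).
Proof.
move=> hK s t a_s st tb; apply: le_trans (hK s t a_s st tb); rewrite ler_norml.
by have := lerB_dist (h t) (h s); have := lerB_dist (h s) (h t); rewrite distrC; lra.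
Qed.

Lemma gronwall (N : set R) (K L c a b : R) (V : normedModType R) (h : R -> V) :
  a <= b -> 0 <= L -> 0 <= c -> lipschitz_between K a b h -> mu.-negligible N ->
  (forall t, a < t < b -> ~ N t ->
     exists2 v, `|v| <= L * `|h t| + c & has_deriv h t v) ->
  `|h b| <= (`|h a| + c * (b - a)) * expR (L * (b - a)).
Proof.
move=> ab L0 c0 hK N0 H; apply: (@gronwall_dini N K L c a b (fun s => `|h s|)) => //.
  exact: lipschitz_between_norm.
move=> t tab nNt; have [v vL hv] := H t tab nNt.
exact: has_deriv_norm_dini hv vL.
Qed.
Definition segment_retract (b s : R) := Num.max 0 (Num.min b s).

Lemma segment_retract_itv b s : 0 <= b -> 0 <= segment_retract b s <= b.
Proof. by move=> b0; rewrite le_max lexx /= ge_max b0 ge_min lexx. Qed.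

Lemma segment_retract_id b s : 0 <= s <= b -> segment_retract b s = s.
Proof.
by move=> /andP[s0 sb]; rewrite /segment_retract (min_idPr sb) (max_idPr s0).
Qed.

Lemma segment_retract_monotone b s t : s <= t ->
  segment_retract b s <= segment_retract b t /\
  segment_retract b t - segment_retract b s <= t - s.
Proof.
move=> st; rewrite /segment_retract.
have [?|?] := leP b s; have [?|?] := leP b t; have [?|?] := leP 0 b;
  have [?|?] := leP 0 s; have [?|?] := leP 0 t; split; lra.
Qed.

Lemma segment_retract_continuous b : continuous (segment_retract b).
Proof.
move=> s; apply: (@continuous_max _ _ (cst 0) (fun s => Num.min b s)).
  exact: cst_continuous.
by apply: (@continuous_min _ _ (cst b) id) => //; exact: cst_continuous.
Qed.
End vector_calculus.

(** * Controls and primitives of bounded measurable functions *)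

Section primitives_and_controls.
Context {R : realType}.
Local Notation mu := (@lebesgue_measure R).

(** A Lebesgue measurable set is a Borel set up to a null set; the superlevel sets
of a control are treated in this way one by one. *)
Lemma nonneg_measurable_in_completion (u : R -> R) (c : R) :
  measurable_fun ([set t | 0 <= t] : set (lebesgueR R)) (u : lebesgueR R -> R) ->
  exists B N : set R, [/\ measurable B, mu.-negligible N &
    [set t | 0 <= t /\ c < u t] = B `|` N].
Proof.
move=> mu_.
have mE : (@measurable _ (lebesgueR R)) = completed_algebra_gen mu.
  exact: g_sigma_completed_algebra_genE.
have mD : measurable ([set t : R | 0 <= t] : set (lebesgueR R)).
  rewrite mE.
  exists [set t : R | 0 <= t].
    have -> : [set t : R | 0 <= t] = `[0, +oo[%classic.
      by apply/seteqP; split=> x /=; rewrite in_itv /= andbT.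
    exact: measurable_itv.
  by exists set0; [exact: negligible_set0 | rewrite setU0].
have := mu_ mD `]c, +oo[%classic (measurable_itv _).
rewrite mE => -[B mB [N N0 BN]].
exists B, N; split => //; rewrite BN; apply/seteqP; split=> t /=.
  by move=> [t0 ct]; split => //; rewrite in_itv /= andbT.
by move=> [t0]; rewrite in_itv /= andbT.
Qed.

(** A control may be replaced by a Borel function without changing the almost
everywhere equation; only countably many null sets, one for each rational
level, are involved. *)
Lemma borel_control (u : R -> R) : switching_function u ->
  exists2 v : R -> R, measurable_fun setT v /\ (forall t, 0 <= v t <= 1) &
    exists2 N, mu.-negligible N & forall t, 0 <= t -> ~ N t -> v t = u t.
Proof.
move=> [mu_ u01].
have /choice[B /choice[N BN]] := fun q : rat => nonneg_measurable_in_completion (ratr q) mu_.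
(* [v] is the supremum of the nonnegative rationals [q <= 1] with [t] in the
   Borel part [B q] of the level set [q < u]. *)
pose r n : rat := odflt 0 (unpickle n).
pose h n t := if (0 <= r n <= 1) then ratr (r n) * \1_(B (r n)) t else 0 : R.
have h01 n t : 0 <= h n t <= 1.
  rewrite /h; case: ifP => [/andP[r0 r1]|_]; last by rewrite lexx ler01.
  have r0' : 0 <= ratr (r n) :> R by rewrite ler0q.
  have r1' : ratr (r n) <= 1 :> R by rewrite -(rmorph1 (ratr : {rmorphism rat -> R})) ler_rat.
  by rewrite indicE; case: (t \in B (r n)); rewrite /= ?mulr1 ?mulr0 ?r0' ?r1' ?lexx ?ler01.
have hub t : has_ubound (range (h ^~ t)).
  by exists 1 => _ [n _ <-]; case/andP: (h01 n t).
pose v t := sups (h ^~ t) 0%N.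
have vE t : v t = sup (range (h ^~ t)).
  rewrite /v /sups /sdrop; congr sup; apply/seteqP; split=> x /=.
    by move=> [n _ <-]; exists n.
  by move=> [n _ <-]; exists n.
have hsup t : has_sup (range (h ^~ t)) by split; [exists (h 0%N t); exists 0%N | exact: hub].
have v01 t : 0 <= v t <= 1.
  rewrite vE; apply/andP; split.
    apply: le_trans (ub_le_sup (hub t) (x := h 0%N t) _); last by exists 0%N.
    by case/andP: (h01 0%N t).
  by apply: ge_sup; [exists (h 0%N t); exists 0%N|move=> _ [n _ <-]; case/andP: (h01 n t)].
exists v; first split => //.
  apply: measurable_fun_sups => // n; rewrite /h; case: (0 <= r n <= 1) => //.
  apply: measurable_funM => //; apply: measurable_indic.
  by case: (BN (r n)).
exists (\bigcup_n N (r n)).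
  by apply: negligible_bigcup => n; case: (BN (r n)).
move=> t t0 nNt; have /andP[u0 u1] := u01 t t0.
have BE q n : r n = q -> B q t <-> ratr q < u t.
  move=> rn; have [_ _ E] := BN q.
  have : [set t | 0 <= t /\ ratr q < u t] t <-> (B q `|` N q) t by rewrite E.
  move=> /= [E1 E2]; split => [Bt|qu]; first by case: E2 => //; left.
  by case: E1 => // Nt; case: nNt; exists n => //; rewrite rn.
apply/le_anti/andP; split; rewrite vE.
  apply: ge_sup; first by exists (h 0%N t); exists 0%N.
  move=> _ [n _ <-]; rewrite /h; case: ifP => // _; rewrite indicE.
  have [/set_mem/(BE _ n erefl) rn|] := boolP (t \in B (r n)); last by rewrite mulr0.
  by rewrite mulr1 ltW.
rewrite leNgt; apply/negP => vu.
have [q] := rat_in_itvoo vu; rewrite in_itv /= => /andP[qv qu].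
have v0 : 0 <= v t by case/andP: (v01 t).
rewrite -vE in qv.
have q01 : 0 <= q <= 1.
  rewrite -(ler0q R) -(ler_rat R) rmorph1.
  by rewrite (le_trans v0 (ltW qv)) (le_trans (ltW qu) u1).
have rq : r (pickle q) = q by rewrite /r pickleK.
have : h (pickle q) t <= v t by rewrite vE; apply: ub_le_sup => //; exists (pickle q).
rewrite /h rq q01 indicE mem_set; last exact/(BE q _ rq).
by rewrite mulr1 leNgt qv.
Qed.

(** Lebesgue's differentiation theorem.  The base point of the integral is [-1],
so that [0] is an interior point of the domain where the primitive is good. *)
Lemma bounded_primitive (f : R -> R) (M : R) : measurable_fun setT f ->
  (forall t, `|f t| <= M) ->
  exists F, [/\ F 0 = 0, forall a b, lipschitz_between M a b F &
    exists2 N, mu.-negligible N &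
      forall t, -1 < t -> ~ N t -> has_deriv F t (f t)].
Proof.
move=> mf fM.
have M0 : 0 <= M by apply: le_trans (fM 0).
have bf (A : set R) : [bounded f x | x in A].
  exists M; split; rewrite ?num_real // => x Mx y _ /=.
  exact: le_trans (fM y) (ltW Mx).
have intf (i : interval R) : (mu [set` i] < +oo)%E ->
    mu.-integrable [set` i] (EFin \o f).
  move=> ifin; apply: measurable_bounded_integrable => //.
  exact: measurable_funTS.
have fin1 (x y : R) b1 b2 : (mu [set` Interval (BSide b1 x) (BSide b2 y)] < +oo)%E.
  by rewrite lebesgue_measure_itv /=; case: ifP => // _; rewrite ltry.
pose I t := (\int[mu]_(x in [set` `[(-1 : R), t]]) f x).
(* The maximum freezes the primitive on the left of the base point. *)
pose F t := I (Num.max t (-1)) - I 0.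
have Ilip s t : -1 <= s -> s <= t -> `|I t - I s| <= M * (t - s).
  move=> s1 st; rewrite /I Rintegral_itvB ?bnd_simp //; last exact: intf.
  have mi : measurable [set` `]s, t]] by exact: measurable_itv.
  apply: (le_trans (le_normr_Rintegral _ _)) => //; first exact/intf/fin1.
  apply: (@le_trans _ _ (\int[mu]_(x in [set` `]s, t]]) cst M x)).
    apply: le_Rintegral => //.
      apply: measurable_bounded_integrable => //; first exact: fin1.
        by apply: measurable_funTS; exact: measurableT_comp.
      exists M; split; rewrite ?num_real // => x Mx y _ /=.
      by rewrite normr_id; exact: le_trans (fM y) (ltW Mx).
    apply: measurable_bounded_integrable => //; first exact: fin1.
    exact: bounded_cst.
  rewrite Rintegral_cst //= lebesgue_measure_itv /= lte_fin.
  by case: ltgtP st => //= -> _; rewrite subrr.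
exists F; split.
- rewrite /F (_ : Num.max 0 (-1) = 0) ?subrr //.
  by apply/max_idPl; rewrite lerN10.
- move=> a b s t _ st _.
  have -> : F t - F s = I (Num.max t (-1)) - I (Num.max s (-1)) by rewrite /F; ring.
  apply: le_trans (Ilip _ _ _ _) _; first by rewrite le_max lexx orbT.
    by rewrite ge_max !le_max st lexx orbT.
  by apply: ler_wpM2l => //; rewrite /Num.max; case: ltP => ?; case: ltP => ?; lra.
have locf : locally_integrable [set: R] f.
  split => //; first exact: openT.
  move=> K _ cK; have mK : measurable K by exact: compact_measurable.
  have : mu.-integrable K (EFin \o f).
    apply: measurable_bounded_integrable => //; first exact: compact_finite_measure.
    exact: measurable_funTS.
  by move=> /integrableP[].
have intf' (y : R) : mu.-integrable [set` Interval (BLeft (-1)) (BRight y)] (EFin \o f).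
  exact/intf/fin1.
have aeP := FTC1 intf' locf.
eexists; first exact: aeP.
move=> t t1 /contrapT /= /(_ t1) [dI IE].
have /is_deriveP H : is_derive t (1 : R) I (f t).
  by split => //; rewrite -derive1E.
move=> e e0; have [d d0 Hd] := H e e0.
exists (Num.min d (t + 1)); first by rewrite lt_min d0; lra.
move=> s; rewrite lt_min => /andP[sd]; rewrite ltr_norml => /andP[st _].
rewrite /F !(max_idPl _); [|lra..].
by rewrite opprB addrA subrK; exact: Hd.
Qed.
End primitives_and_controls.

(** * Caratheodory solutions *)

Section caratheodory.
Context {R : realType}.
Local Notation mu := (@lebesgue_measure R).
Local Notation plane := 'rV[R]_2.

Lemma lipschitz_continuous (V : normedModType R) (K : R) (f : R -> V) :
  (forall a b, lipschitz_between K a b f) -> continuous f.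
Proof.
move=> fK x.
have K0 : 0 <= K.
  have := fK 0 1 0 1 (lexx _) ler01 (lexx _); rewrite subr0 mulr1.
  exact: le_trans.
have K1 : 0 < K + 1 by rewrite ltr_wpDl.
apply/cvgrPdist_le => e e0; exists (e / (K + 1)); first by rewrite /= divr_gt0.
move=> y; rewrite /ball /= ltr_pdivlMr // => xy.
have h : K * `|x - y| <= e.
  by apply: (le_trans _ (ltW xy)); rewrite mulrC ler_wpM2l // lerDl.
apply: le_trans h; have [xy'|xy'] := leP x y.
  rewrite distrC (distrC x) (ger0_norm (x := y - x)) ?subr_ge0 //.
  exact: (fK x y).
rewrite (gtr0_norm (x := x - y)) ?subr_gt0 //.
by apply: (fK y x) => //; exact: ltW.
Qed.

Lemma ord2_cases (i : 'I_2) : i = 0 \/ i = 1.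
Proof. by case: i => -[|[|//]] ?; [left|right]; exact/val_inj. Qed.

Lemma plane_primitive (w : R -> plane) (M : R) (p : plane) :
  (forall i, measurable_fun setT (fun t => w t 0 i)) -> (forall t, `|w t| <= M) ->
  exists q, [/\ q 0 = p, forall a b, lipschitz_between M a b q &
    exists2 N, mu.-negligible N &
      forall t, -1 < t -> ~ N t -> has_deriv q t (w t)].
Proof.
move=> mw wM; have M0 : 0 <= M by apply: le_trans (wM 0).
have wiM i t : `|w t 0 i| <= M by exact: le_trans (coord_norm_le _ _) (wM t).
have [F0 [F00 F0L [N0 N00 F0d]]] := bounded_primitive (mw 0) (wiM 0).
have [F1 [F10 F1L [N1 N10 F1d]]] := bounded_primitive (mw 1) (wiM 1).
pose F (i : 'I_2) := if i == 0 then F0 else F1.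
exists (fun t => p + \row_i F i t); split.
- apply/rowP => i; rewrite !mxE /F; case: ifP => _; by rewrite ?F00 ?F10 addr0.
- move=> a b s t a_s st tb; rewrite opprD addrACA subrr add0r.
  apply/row_norm_le; first by rewrite mulr_ge0 // subr_ge0.
  move=> i; rewrite !mxE /F; case: ifP => _; [exact: (F0L a b)|exact: (F1L a b)].
exists (N0 `|` N1); first exact: negligibleU.
move=> t t1 /not_orP[nN0 nN1] e e0.
have [d0 d00 H0] := F0d t t1 nN0 e e0; have [d1 d10 H1] := F1d t t1 nN1 e e0.
exists (Num.min d0 d1); first by rewrite lt_min d00.
move=> s; rewrite lt_min => /andP[sd0 sd1]; rewrite opprD addrACA subrr add0r.
apply/row_norm_le; first by rewrite mulr_ge0 // ltW.
move=> i; rewrite !mxE /F; case: (ord2_cases i) => -> /=; [exact: H0|exact: H1].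
Qed.

(** A mean value inequality against an arbitrary primitive [phi], used below with
an exponential one. *)
Lemma ae_growth_le_primitive (N : set R) (K a b B : R) (f phi dphi : R -> R) :
  a <= b -> lipschitz_between K a b f -> mu.-negligible N ->
  (forall t, has_deriv phi t (dphi t)) -> 0 <= B ->
  (forall t, a <= t <= b -> `|dphi t| <= B) ->
  (forall t, a < t < b -> ~ N t -> exists2 c, c <= dphi t & has_deriv f t c) ->
  f b - f a <= phi b - phi a.
Proof.
move=> ab fK N0 phid B0 dB Hf.
suff : f b - phi b <= f a - phi a by lra.
have phiB : lipschitz_between B a b phi.
  move=> s t a_s st tb.
  have st' x : s <= x <= t -> `|dphi x| <= B.
    by move=> /andP[sx xt]; apply: dB; apply/andP; split; lra.
  rewrite ler_norml; apply/andP; split.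
    suff : - phi t - (- phi s) <= B * (t - s) by lra.
    apply: (@everywhere_derive_le_growth R B s t (fun x => - phi x)) => // x /st' xB.
    exists (- dphi x); last exact: has_derivN.
    by move: xB; rewrite ler_norml; lra.
  apply: everywhere_derive_le_growth => // x /st' xB; exists (dphi x) => //.
  by move: xB; rewrite ler_norml; lra.
have N0' : mu.-negligible (N `|` [set a]).
  by apply: negligibleU => //; apply/negligibleP => //=; exact: lebesgue_measure_set1.
apply: (@ae_dini_le0_nonincreasing R _ (K + B) a b (fun x => f x - phi x)) N0' _ => //.
  move=> s t a_s st tb; rewrite mulrDl.
  rewrite (_ : f t - phi t - _ = (f t - f s) - (phi t - phi s)); last by ring.
  apply: (le_trans (ler_normB _ _)); apply: lerD; [exact: fK|exact: phiB].
move=> t /andP[at_ tb] nNt.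
have at' : a < t.
  by rewrite lt_neqAle at_ andbT; apply/eqP => h; apply: nNt; right.
have [c cd Hc] := Hf t ltac:(by rewrite at' tb) (fun h => nNt (or_introl h)).
move=> e e0; have := has_derivB Hc (phid t).
move=> /(_ e e0)[d d0 Hd]; exists d => // s ts sd.
have := Hd s; rewrite ger0_norm ?subr_ge0 // => /(_ ltac:(lra)).
rewrite ler_norml => /andP[_].
have -> : (s - t) *: (c - dphi t : R^o) = (c - dphi t) * (s - t) by rewrite mulrC.
have : (c - dphi t) * (s - t) <= 0 * (s - t) by apply: ler_wpM2r; lra.
lra.
Qed.

Lemma has_deriv_scale (f : R -> R) (t c d : R) :
  has_deriv f t d -> has_deriv (fun s => c * f s) t (c * d).
Proof.
by move=> /is_deriveP H; apply/is_deriveP; exact: (@is_deriveZ R R R^o f c t 1 d).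
Qed.

Lemma has_deriv_expRM (c t : R) :
  has_deriv (fun s => expR (c * s)) t (c * expR (c * t)).
Proof.
apply/is_deriveP; rewrite mulrC.
apply: (@is_derive1_comp _ expR (fun s => c * s)).
apply/is_deriveP => e e0; exists 1 => // s _.
have -> : c * s - c * t - (s - t) *: (c : R^o) = 0.
  by rewrite [_ *: _]mulrC -mulrBr subrr.
by rewrite normr0 mulr_ge0 // ltW.
Qed.

(** Completeness, together with the rate of convergence that a contraction
produces. *)
Lemma geometric_limit d (x : nat -> 'rV[R]_d) (c : R) :
  (forall m, `|x m.+1 - x m| <= c / 2 ^+ m) ->
  exists l, forall m, `|x m - l| <= 2 * c / 2 ^+ m.
Proof.
move=> Hx.
have p2 n : (0 : R) < 2 ^+ n by rewrite exprn_gt0.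
have c0 : 0 <= c by have := Hx 0%N; rewrite expr0 divr1; exact: le_trans.
have far n k : `|x n - x (n + k)%N| <= 2 * c / 2 ^+ n - 2 * c / 2 ^+ (n + k).
  elim: k => [|k IH]; first by rewrite addn0 !subrr normr0.
  have -> : x n - x (n + k.+1)%N = (x n - x (n + k)%N) - (x (n + k).+1 - x (n + k)%N).
    by rewrite addnS opprB addrA subrK.
  apply: (le_trans (ler_normB _ _)); apply: (le_trans (lerD IH (Hx _))).
  rewrite addnS exprS invfM; lra.
have far' n k : `|x n - x (n + k)%N| <= 2 * c / 2 ^+ n.
  by apply: (le_trans (far n k)); rewrite gerBl divr_ge0 ?mulr_ge0 // ltW.
have small e : 0 < e -> exists n, 2 * c / 2 ^+ n <= e.
  move=> e0; exists (Num.truncn (2 * c / e)).+1.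
  rewrite ler_pdivrMr // [e * _]mulrC -ler_pdivrMr //.
  apply: le_trans (ltW (truncnS_gt _)) _.
  by rewrite -natrX ler_nat ltnW // ltn_expl.
have : cvg (x @ \oo).
  apply/cauchy_cvgP/cauchy_ballP => e e0.
  have [n Hn] := small (e / 4) ltac:(by rewrite divr_gt0).
  exists ([set x m | m in [set m | (n <= m)%N]], [set x m | m in [set m | (n <= m)%N]]).
    by split; exists n => // m /= nm; exists m.
  move=> [y z] /= [[m /= nm <-] [k /= nk <-]]; rewrite -ball_normE /ball_ /=.
  have hm := far' n (m - n)%N; have hk := far' n (k - n)%N.
  rewrite !subnKC // in hm hk.
  have -> : x m - x k = (x n - x k) - (x n - x m) by rewrite opprB [RHS]addrC addrA subrK.
  by apply: (le_lt_trans (ler_normB _ _)); lra.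
move=> /cvg_ex[l xl]; exists l => n; apply/ler_addgt0Pr => e e0.
move: xl => /cvgrPdist_le/(_ e e0)[m _ Hm].
have := Hm (n + m)%N (leq_addl _ _); have := far' n m.
have -> : x n - l = (x n - x (n + m)%N) - (l - x (n + m)%N) by rewrite opprB addrA subrK.
by move=> h1 h2; apply: (le_trans (ler_normB _ _)); apply: lerD.
Qed.

Section picard.
Variables (A B : plane -> plane) (L M : R) (v : R -> R) (p : plane).
Hypotheses (L0 : 0 < L)
  (AL : forall x y, `|A x - A y| <= L * `|x - y|) (AM : forall x, `|A x| <= M)
  (BL : forall x y, `|B x - B y| <= L * `|x - y|) (BM : forall x, `|B x| <= M)
  (mv : measurable_fun setT v) (v01 : forall t, 0 <= v t <= 1).

Let G t x := v t *: A x + (1 - v t) *: B x.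

Lemma convex_norm_le (s c : R) (x y : plane) :
  0 <= s <= 1 -> `|x| <= c -> `|y| <= c -> `|s *: x + (1 - s) *: y| <= c.
Proof.
move=> /andP[s0 s1] xc yc; apply: (le_trans (ler_normD _ _)).
rewrite !normrZ (ger0_norm s0) (ger0_norm (x := 1 - s)) ?subr_ge0 //.
have : s * `|x| <= s * c by exact: ler_wpM2l.
have : (1 - s) * `|y| <= (1 - s) * c by apply: ler_wpM2l; rewrite ?subr_ge0.
lra.
Qed.

Let GM t x : `|G t x| <= M. Proof. exact: convex_norm_le. Qed.
Let M0 : 0 <= M. Proof. by apply: le_trans (AM 0). Qed.
Let GL t x y : `|G t x - G t y| <= L * `|x - y|.
Proof.
have -> : G t x - G t y = v t *: (A x - A y) + (1 - v t) *: (B x - B y).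
  by rewrite /G opprD addrACA -!scalerBr.
exact: convex_norm_le.
Qed.

Let is_step (q q' : R -> plane) := exists2 N, mu.-negligible N &
  forall t, -1 < t -> ~ N t -> has_deriv q' t (G t (q t)).

Let adm (q : R -> plane) := q 0 = p /\ forall a b, lipschitz_between M a b q.

Let measurable_field (C : plane -> plane) (q : R -> plane) i :
  (forall x y, `|C x - C y| <= L * `|x - y|) ->
  (forall a b, lipschitz_between M a b q) ->
  measurable_fun setT (fun t => C (q t) 0 i).
Proof.
move=> CL qM; apply: continuous_measurable_fun.
apply: (@lipschitz_continuous _ (L * M)) => a b s t a_s st tb.
have := coord_norm_le (C (q t) - C (q s)) i; rewrite !mxE => h.
apply: (le_trans h); apply: (le_trans (CL _ _)).
by rewrite -mulrA ler_pM2l //; exact: (qM a b).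
Qed.

Let step q : adm q -> exists q', adm q' /\ is_step q q'.
Proof.
move=> [q0 qM].
have [|q' [q'0 q'M q'd]] := @plane_primitive (fun t => G t (q t)) M p _ (fun t => GM t _).
  move=> i; rewrite (_ : (fun t => G t (q t) 0 i) =
      (v \* (fun t => A (q t) 0 i)) \+ ((cst 1 \- v) \* (fun t => B (q t) 0 i))).
    apply: measurable_funD; apply: measurable_funM => //.
    - exact: measurable_field.
    - exact: measurable_funB.
    - exact: measurable_field.
  by apply/funext => t; rewrite !mxE.
by exists q'.
Qed.

Let k := 2 * L.
Let W (t : R) := expR (k * t) + expR (- k * t).

Let c_ge0 (c : R) (x y : R -> plane) :
  (forall t, -1 <= t -> `|x t - y t| <= c * W t) -> 0 <= c.
Proof.
move=> /(_ 0 ltac:(lra)) /(le_trans (normr_ge0 _)).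
by rewrite pmulr_lge0 // addr_gt0 // expR_gt0.
Qed.

Let growth x y x' y' c : adm x' -> adm y' -> is_step x x' -> is_step y y' ->
  (forall t, -1 <= t -> `|x t - y t| <= c * W t) ->
  forall i s t, -1 <= s -> s <= t ->
    (x' t - y' t) 0 i - (x' s - y' s) 0 i <=
    c / 2 * (expR (k * t) - expR (- k * t)) - c / 2 * (expR (k * s) - expR (- k * s)).
Proof.
move=> [_ x'M] [_ y'M] [N1 N10 dx] [N2 N20 dy] xy i s t s1 st.
have c0 := c_ge0 xy.
pose dphi t := L * (c * W t).
have phid r : has_deriv (fun t => c / 2 * (expR (k * t) - expR (- k * t))) r (dphi r).
  have -> : dphi r = (c / 2) * (k * expR (k * r) - (- k) * expR (- k * r)).
    by rewrite /dphi /W /k; field.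
  by apply: has_deriv_scale; apply: has_derivB; exact: has_deriv_expRM.
pose T := `|s| + `|t|.
have WT r : s <= r <= t -> `|W r| <= expR (k * T) + expR (k * T).
  move=> /andP[sr rt]; rewrite ger0_norm; last by rewrite addr_ge0 // expR_ge0.
  have : - T <= r <= T.
    have := ler_norm t; have := ler_norm (- s); rewrite normrN /T.
    by have := normr_ge0 s; have := normr_ge0 t; lra.
  move=> /andP[r1 r2]; have k0 : 0 < k by rewrite mulr_gt0.
  apply: lerD; rewrite ler_expR; first by rewrite ler_pM2l.
  by rewrite mulNr -mulrN ler_pM2l // lerNl.
apply: (@ae_growth_le_primitive (N1 `|` N2) (M + M) s t (L * (c * (expR (k * T) + expR (k * T))))
  (fun t => (x' t - y' t) 0 i) (fun t => c / 2 * (expR (k * t) - expR (- k * t))) dphi) => //.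
- move=> a b sa ab bt.
  have := coord_norm_le ((x' b - y' b) - (x' a - y' a)) i; rewrite !mxE => h.
  apply: (le_trans h).
  have -> : x' b - y' b - (x' a - y' a) = (x' b - x' a) - (y' b - y' a).
    by rewrite !opprB addrACA [RHS]addrACA; congr (_ + _); rewrite addrC.
  rewrite mulrDl.
  by apply: (le_trans (ler_normB _ _)); apply: lerD; [exact: (x'M s t)|exact: (y'M s t)].
- exact: negligibleU.
- by rewrite !mulr_ge0 ?addr_ge0 ?expR_ge0 // ltW.
- move=> r /WT Wr; rewrite /dphi !normrM (gtr0_norm L0) (ger0_norm c0).
  by rewrite ler_pM2l // ler_wpM2l.
move=> r /andP[sr rt] /not_orP[nN1 nN2].
have r1 : -1 < r by exact: le_lt_trans sr.
exists ((G r (x r) - G r (y r)) 0 i).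
  apply: (le_trans (ler_norm _)); apply: (le_trans (coord_norm_le _ _)).
  apply: (le_trans (GL _ _ _)); rewrite /dphi ler_pM2l //; exact/xy/ltW.
apply: has_deriv_coord; apply: has_derivB; [exact: dx | exact: dy].
Qed.

Let contract x y x' y' c : adm x' -> adm y' -> is_step x x' -> is_step y y' ->
  (forall t, -1 <= t -> `|x t - y t| <= c * W t) ->
  forall t, -1 <= t -> `|x' t - y' t| <= c / 2 * W t.
Proof.
move=> ax ay sx sy xy t t1; have c0 := c_ge0 xy.
have yx r : -1 <= r -> `|y r - x r| <= c * W r by rewrite distrC; exact: xy.
have c20 : 0 <= c / 2 by rewrite divr_ge0.
apply/row_norm_le; first by rewrite mulr_ge0 // addr_ge0 // expR_ge0.
move=> i.
have D0 : (x' 0 - y' 0) 0 i = 0 by rewrite ax.1 ay.1 subrr mxE.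
have D0' : (y' 0 - x' 0) 0 i = 0 by rewrite ax.1 ay.1 subrr mxE.
have Ds : (y' t - x' t) 0 i = - ((x' t - y' t) 0 i) by rewrite !mxE opprB.
have e1 : 0 <= c / 2 * expR (k * t) by rewrite mulr_ge0 // expR_ge0.
have e2 : 0 <= c / 2 * expR (- k * t) by rewrite mulr_ge0 // expR_ge0.
rewrite ler_norml /W; have [t0|t0] := leP 0 t.
  have := growth ax ay sx sy xy i (s := 0) ltac:(lra) t0.
  have := growth ay ax sy sx yx i (s := 0) ltac:(lra) t0.
  by rewrite Ds D0 D0' !mulr0 subrr mulr0; lra.
have := growth ax ay sx sy xy i t1 (ltW t0).
have := growth ay ax sy sx yx i t1 (ltW t0).
by rewrite Ds D0 D0' !mulr0 subrr mulr0; lra.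
Qed.

(** Picard iteration.  The time axis is unbounded, so the iterates are compared in
the weighted norm [sup |x t| / W t], in which one step contracts distances by
[1 / 2] because the primitive of [L W] is at most [W / 2]. *)
Theorem caratheodory_existence : exists q, [/\ q 0 = p,
  forall a b, lipschitz_between M a b q & exists2 N, mu.-negligible N &
    forall t, -1 < t -> ~ N t ->
      has_deriv q t (v t *: A (q t) + (1 - v t) *: B (q t))].
Proof.
pose S := {q : R -> plane | adm q}.
have adm0 : adm (fun=> p).
  split=> // a b s t _ st _; rewrite subrr normr0 mulr_ge0 // subr_ge0 //.
have /choice[nxt nxtP] : forall q : S, exists q' : S, is_step (sval q) (sval q').
  by move=> [q aq]; have [q' [aq' sq]] := step aq; exists (exist _ q' aq').
pose x n := sval (iter n nxt (exist _ _ adm0)).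
have ax n : adm (x n) by exact: svalP.
have sx n : is_step (x n) (x n.+1) by exact: nxtP.
(* [C] controls the first increment, since [|t| <= W t / k]. *)
pose C := M / k.
have k0 : 0 < k by rewrite /k mulr_gt0.
have C0 : 0 <= C by rewrite divr_ge0 // ltW.
have near0 n t : -1 <= t -> `|x n.+1 t - x n t| <= C / 2 ^+ n * W t.
  elim: n t => [|n IH] t t1; last first.
    by rewrite exprSr invfM mulrA; apply: contract (ax _) (ax _) (sx _) (sx _) IH t t1.
  rewrite expr0 divr1; have [x10 x1M] := ax 1%N.
  have -> : x 0%N t = p by [].
  rewrite -x10 /C mulrAC ler_pdivlMr //.
  have [t0|t0] := leP 0 t.
    have := x1M 0 t 0 t (lexx _) t0 (lexx _); rewrite subr0 => h.
    apply: le_trans (ler_wpM2r (ltW k0) h) _; rewrite -mulrA; apply: ler_wpM2l => //.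
    have := expR_ge1Dx (k * t); have := expR_ge0 (- k * t); rewrite /W; lra.
  have := x1M t 0 t 0 (lexx _) (ltW t0) (lexx _); rewrite distrC sub0r => h.
  apply: le_trans (ler_wpM2r (ltW k0) h) _; rewrite -mulrA; apply: ler_wpM2l => //.
  have := expR_ge1Dx (- k * t); have := expR_ge0 (k * t); rewrite /W; lra.
(* The estimates hold from [-1] on only, so the limit is taken after moving
   earlier times to [-1]. *)
pose cl (t : R) := Num.max t (-1).
have /choice[q qP] : forall t, exists l : plane, forall n, `|x n (cl t) - l| <= 2 * (C * W (cl t)) / 2 ^+ n.
  move=> t; apply: (@geometric_limit 2 (fun n => x n (cl t))) => n; rewrite mulrAC; apply: near0.
  by rewrite le_max lexx orbT.
have W0 t : 0 <= W t by rewrite addr_ge0 // expR_ge0.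
have small (c e : R) : 0 < e -> exists n, c / 2 ^+ n <= e.
  move=> e0; exists (Num.truncn (c / e)).+1.
  rewrite ler_pdivrMr ?exprn_gt0 // [e * _]mulrC -ler_pdivrMr //.
  apply: le_trans (ltW (truncnS_gt _)) _.
  by rewrite -natrX ler_nat ltnW // ltn_expl.
have aq : adm q.
  split.
    apply/eqP; rewrite -subr_eq0 -normr_le0; apply/ler_addgt0Pr => e e0; rewrite add0r.
    have [n Hn] := small (2 * (C * W (cl 0))) e e0.
    by apply: le_trans Hn; have := qP 0 n; rewrite {1}/cl max_l ?lerN10 // (ax n).1 distrC.
  move=> a b s t a_s st tb; apply/ler_addgt0Pr => e e0.
  have [n Hn] := small (2 * (C * W (cl t)) + 2 * (C * W (cl s))) e e0.
  have cts : `|x n (cl t) - x n (cl s)| <= M * (t - s).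
    have clst : cl s <= cl t by rewrite /cl ge_max !le_max st lexx orbT.
    apply: (le_trans ((ax n).2 (cl s) (cl t) _ _ (lexx _) clst (lexx _))).
    by apply: ler_wpM2l => //; rewrite /cl /Num.max; case: ltP => ?; case: ltP => ?; lra.
  have -> : q t - q s = (x n (cl t) - x n (cl s)) - (x n (cl t) - q t) + (x n (cl s) - q s).
    by rewrite opprB [RHS]addrAC [X in _ = X + _]addrA subrK [RHS]addrC addrA subrK.
  apply: (le_trans (ler_normD _ _)); have h1 := ler_normB (x n (cl t) - x n (cl s)) (x n (cl t) - q t).
  have := qP t n; have := qP s n; rewrite mulrDl in Hn; lra.
have [q' [aq' sq]] := step aq.
have qx n t : -1 <= t -> `|x n t - q t| <= 2 * C / 2 ^+ n * W t.
  by move=> t1; have := qP t n; rewrite {1 2}/cl max_l // => h; apply: (le_trans h); rewrite !mulrA mulrAC.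
have qq n t : -1 <= t -> `|q' t - x n.+1 t| <= C / 2 ^+ n * W t.
  move=> t1; have -> : C / 2 ^+ n = (2 * C / 2 ^+ n) / 2 by lra.
  apply: contract aq' (ax _) sq (sx _) _ t t1 => r r1.
  by rewrite distrC; exact: qx.
have q'q t : -1 <= t -> q' t = q t.
  move=> t1; apply/eqP; rewrite -subr_eq0 -normr_le0; apply/ler_addgt0Pr => e e0; rewrite add0r.
  have [n Hn] := small (2 * C * W t) e e0; apply: le_trans Hn.
  have -> : q' t - q t = (q' t - x n.+1 t) + (x n.+1 t - q t) by rewrite addrA subrK.
  apply: (le_trans (ler_normD _ _)).
  have := qq n t t1; have := qx n.+1 t t1; rewrite exprSr invfM; lra.
exists q'; split; [exact: aq'.1 | exact: aq'.2 |].
have [N N0 HN] := sq; exists N => // t t1 nN.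
by rewrite q'q ?ltW //; exact: HN.
Qed.
End picard.
End caratheodory.

(** * Smooth planar fields *)

Section smooth_fields.
Context {R : realType}.
Local Notation mu := (@lebesgue_measure R).
Local Notation plane := 'rV[R]_2.
Implicit Types (f X : plane -> plane) (x y p : plane).

Definition partial (i : 'I_2) f x := 'D_(delta_mx 0 i) f x.
Definition jacobian_apply f x (v : plane) :=
  v 0 0 *: partial 0 f x + v 0 1 *: partial 1 f x.

Lemma smooth_continuous f : smooth f -> continuous f.
Proof. by move=> /(_ 0%N)[]. Qed.

Lemma smooth_partial f i : smooth f -> smooth (partial i f).
Proof. by move=> sf k; have [_ /(_ i)[]] := sf k.+1. Qed.

Lemma partial_has_deriv f i x t : smooth f ->
  has_deriv (fun s => f (x + s *: delta_mx 0 i)) t (partial i f (x + t *: delta_mx 0 i)).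
Proof.
move=> /(_ 1%N)[_ /(_ i)[/(_ (x + t *: delta_mx 0 i)) df _]] e e0.
have : h^-1 *: ((f \o shift (x + t *: delta_mx 0 i)) (h *: delta_mx 0 i) -
    f (x + t *: delta_mx 0 i)) @[h --> 0^'] --> partial i f (x + t *: delta_mx 0 i).
  exact: df.
move=> /cvgrPdist_le/(_ e e0)[d /= d0 Hd]; exists d => // s sd.
have [->|st] := eqVneq s t; first by rewrite !subrr scale0r subrr !normr0 mulr0.
have st0 : s - t != 0 by rewrite subr_eq0.
have := Hd (s - t); rewrite /ball /= sub0r normrN => /(_ sd st0).
rewrite /shift /= addrCA -scalerDl subrK => He.
rewrite -[f (x + s *: _) - f (x + t *: _)](scalerKV st0) -scalerBr normrZ mulrC ler_wpM2r //.
by rewrite distrC.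
Qed.

Lemma box_compact (M : R) : compact [set x : plane | `|x| <= M].
Proof.
apply: bounded_closed_compact.
  by exists M; split; rewrite ?num_real // => K MK x /= /le_trans; apply; exact: ltW.
have -> : [set x : plane | `|x| <= M] = (fun x : plane => `|x|) @^-1` [set r | r <= M].
  by [].
apply: closed_comp; last exact: closed_le.
by move=> x _; exact: norm_continuous.
Qed.

Lemma continuous_box_bounded f (M : R) : continuous f ->
  exists2 K, 0 < K & forall x, `|x| <= M -> `|f x| <= K.
Proof.
move=> cf; have cfM : {within [set x : plane | `|x| <= M], continuous f}.
  exact: continuous_subspaceT.
have /compact_bounded[K [_ HK]] := continuous_compact cfM (@box_compact M).
exists (`|K| + 1); first by rewrite ltr_wpDl.
move=> x xM; apply: (HK (`|K| + 1)); last by exists x.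
by rewrite (le_lt_trans (ler_norm K)) // ltrDl.
Qed.

(** Moving along one coordinate axis the mean value inequality in one variable is
enough; [w = 0] yields Lipschitz bounds and [w] equal to the partial derivative
at the start yields a Taylor estimate. *)
Lemma coordinate_step f i x (w : plane) (K d : R) : smooth f -> 0 <= K ->
  (forall s, `|s| <= `|d| -> 0 <= s * d ->
     `|partial i f (x + s *: delta_mx 0 i) - w| <= K) ->
  `|f (x + d *: delta_mx 0 i) - f x - d *: w| <= K * `|d|.
Proof.
move=> sf K0 H; pose g (s : R) := f (x + s *: delta_mx 0 i) - s *: w.
have gd s : has_deriv g s (partial i f (x + s *: delta_mx 0 i) - w).
  apply: has_derivB; first exact: partial_has_deriv.
  move=> e e0; exists 1 => // r _.
  by rewrite -scalerBl subrr normr0 mulr_ge0 // ltW.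
have -> : f (x + d *: delta_mx 0 i) - f x - d *: w = g d - g 0.
  by rewrite /g !scale0r addr0 subr0 addrAC.
have [d0|d0] := leP 0 d.
  have L : lipschitz_between K 0 d g.
    apply: everywhere_derive_bounded_lipschitz => // s /andP[s0 sd].
    by eexists; last exact: gd; apply: H; rewrite ?mulr_ge0 // !ger0_norm.
  by rewrite (ger0_norm d0) -[X in K * X]subr0; exact: L.
have L : lipschitz_between K d 0 g.
  apply: everywhere_derive_bounded_lipschitz => // s /andP[ds s0].
  eexists; last exact: gd; apply: H; last by rewrite nmulr_lge0.
  by rewrite !ler0_norm // ?lerN2 // ltW.
rewrite distrC (ltr0_norm d0) -[- d]sub0r; apply: L => //; exact: ltW.
Qed.

(** Two points are joined by one step along each axis; the two bounds that follow
say that this path stays in the box, a ball for the supremum norm, and no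
farther from its origin than the end point. *)
Lemma two_coordinate_steps x y :
  let z := x + (y - x) 0 0 *: delta_mx 0 0 in
  y = z + (y - x) 0 1 *: delta_mx 0 1.
Proof.
apply/rowP => i; rewrite !mxE; case: (ord2_cases i) => -> /=.
  by rewrite mulr1 mulr0 addr0 addrC subrK.
by rewrite mulr0 mulr1 addr0 addrC subrK.
Qed.

Lemma coordinate_stays_in_box (a b s M : R) : `|a| <= M -> `|b| <= M ->
  `|s| <= `|b - a| -> 0 <= s * (b - a) -> `|a + s| <= M.
Proof.
rewrite !ler_norml => aM bM sb s0; have [ba|ba] := leP 0 (b - a).
  rewrite (ger0_norm ba) in sb; have [b0|b0] := eqVneq (b - a) 0.
    by rewrite b0 in sb; lra.
  have s1 : 0 <= s by move: s0; rewrite pmulr_lge0 // lt_neqAle eq_sym b0.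
  lra.
rewrite (ltr0_norm ba) in sb; rewrite nmulr_lge0 // in s0; lra.
Qed.

Lemma first_step_in_box x y s (M : R) : `|x| <= M -> `|y| <= M ->
  `|s| <= `|(y - x) 0 0| -> 0 <= s * (y - x) 0 0 ->
  let z := x + s *: delta_mx 0 0 in `|z| <= M /\ `|z - x| <= `|y - x|.
Proof.
move=> xM yM sb s0 /=; have M0 : 0 <= M by exact: le_trans xM.
split; apply/row_norm_le => // i; rewrite !mxE; case: (ord2_cases i) => -> /=.
- rewrite mulr1; apply: (coordinate_stays_in_box (b := y 0 0)).
  + exact: le_trans (coord_norm_le _ _) xM.
  + exact: le_trans (coord_norm_le _ _) yM.
  + by rewrite !mxE in sb.
  + by rewrite !mxE in s0.
- by rewrite mulr0 addr0; exact: le_trans (coord_norm_le _ _) xM.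
- by rewrite mulr1 addrAC subrr add0r; exact: le_trans sb (coord_norm_le _ _).
- by rewrite mulr0 addr0 subrr normr0.
Qed.

Lemma second_step_in_box x y s (M : R) : `|x| <= M -> `|y| <= M ->
  `|s| <= `|(y - x) 0 1| -> 0 <= s * (y - x) 0 1 ->
  let z := x + (y - x) 0 0 *: delta_mx 0 0 + s *: delta_mx 0 1 in
  `|z| <= M /\ `|z - x| <= `|y - x|.
Proof.
move=> xM yM sb s0 /=; have M0 : 0 <= M by exact: le_trans xM.
split; apply/row_norm_le => // i; rewrite !mxE; case: (ord2_cases i) => -> /=.
- rewrite mulr1 mulr0 addr0 addrC subrK; exact: le_trans (coord_norm_le _ _) yM.
- rewrite mulr0 addr0 mulr1; apply: (coordinate_stays_in_box (b := y 0 1)).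
  + exact: le_trans (coord_norm_le _ _) xM.
  + exact: le_trans (coord_norm_le _ _) yM.
  + by rewrite !mxE in sb.
  + by rewrite !mxE in s0.
- rewrite mulr1 mulr0 addr0 addrAC subrr add0r.
  by have := coord_norm_le (y - x) 0; rewrite !mxE.
- by rewrite mulr0 addr0 mulr1 addrAC subrr add0r; exact: le_trans sb (coord_norm_le _ _).
Qed.

Lemma smooth_lipschitz f (M : R) : smooth f -> exists2 K, 0 < K &
  forall x y, `|x| <= M -> `|y| <= M -> `|f x - f y| <= K * `|x - y|.
Proof.
move=> sf.
have [K0 K00 H0] := continuous_box_bounded M (smooth_continuous (smooth_partial 0 sf)).
have [K1 K10 H1] := continuous_box_bounded M (smooth_continuous (smooth_partial 1 sf)).
exists (K0 + K1); first exact: addr_gt0.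
move=> y x yM xM; pose z := x + (y - x) 0 0 *: delta_mx 0 0.
have h0 : `|f z - f x| <= K0 * `|(y - x) 0 0|.
  have := @coordinate_step f 0 x 0 K0 ((y - x) 0 0) sf (ltW K00).
  rewrite scaler0 subr0; apply => s sb s0; rewrite subr0; apply: H0.
  by have [] := first_step_in_box xM yM sb s0.
have h1 : `|f y - f z| <= K1 * `|(y - x) 0 1|.
  have := @coordinate_step f 1 z 0 K1 ((y - x) 0 1) sf (ltW K10).
  rewrite scaler0 subr0 -two_coordinate_steps; apply => s sb s0; rewrite subr0; apply: H1.
  by have [] := second_step_in_box xM yM sb s0.
have -> : f y - f x = (f y - f z) + (f z - f x) by rewrite addrA subrK.
apply: (le_trans (ler_normD _ _)); rewrite mulrDl addrC.
apply: lerD; [apply: (le_trans h0)|apply: (le_trans h1)];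
  by apply: ler_wpM2l; [exact: ltW|exact: coord_norm_le].
Qed.

(** First-order expansion with a quadratic remainder, since the partial derivatives
are themselves Lipschitz on boxes. *)
Lemma smooth_taylor f (M : R) : smooth f -> exists2 K, 0 < K &
  forall x y, `|x| <= M -> `|y| <= M ->
    `|f y - f x - jacobian_apply f x (y - x)| <= K * `|y - x| ^+ 2.
Proof.
move=> sf.
have [K0 K00 H0] := smooth_lipschitz M (smooth_partial 0 sf).
have [K1 K10 H1] := smooth_lipschitz M (smooth_partial 1 sf).
exists (K0 + K1); first exact: addr_gt0.
move=> x y xM yM; pose z := x + (y - x) 0 0 *: delta_mx 0 0.
have h0 : `|f z - f x - (y - x) 0 0 *: partial 0 f x| <= K0 * `|y - x| * `|(y - x) 0 0|.
  apply: coordinate_step; [exact: sf | exact: mulr_ge0 (ltW K00) _ |].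
  move=> s sb s0; have [zM zx] := first_step_in_box xM yM sb s0.
  apply: (le_trans (H0 _ _ zM xM)); rewrite (ler_pM2l K00); exact: zx.
have h1 : `|f y - f z - (y - x) 0 1 *: partial 1 f x| <= K1 * `|y - x| * `|(y - x) 0 1|.
  have := @coordinate_step f 1 z (partial 1 f x) (K1 * `|y - x|) ((y - x) 0 1) sf.
  rewrite -two_coordinate_steps; apply; first exact: mulr_ge0 (ltW K10) _.
  move=> s sb s0; have [zM zx] := second_step_in_box xM yM sb s0.
  apply: (le_trans (H1 _ _ zM xM)); rewrite (ler_pM2l K10); exact: zx.
have -> : f y - f x - jacobian_apply f x (y - x) =
  (f z - f x - (y - x) 0 0 *: partial 0 f x) + (f y - f z - (y - x) 0 1 *: partial 1 f x).
  by rewrite [RHS]addrACA -opprD; congr (_ - _); rewrite [RHS]addrC addrA subrK.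
apply: (le_trans (ler_normD _ _)); rewrite expr2 mulrA [X in X * _]mulrDl mulrDl.
apply: lerD; [apply: (le_trans h0)|apply: (le_trans h1)];
  by apply: ler_wpM2l; [rewrite mulr_ge0 // ltW|exact: coord_norm_le].
Qed.

Lemma jacobian_applyD f x v w :
  jacobian_apply f x (v + w) = jacobian_apply f x v + jacobian_apply f x w.
Proof.
rewrite /jacobian_apply; move: (partial 0 f x) (partial 1 f x) => P Q.
by rewrite !mxE !scalerDl addrACA.
Qed.

Lemma jacobian_applyZ f x c v :
  jacobian_apply f x (c *: v) = c *: jacobian_apply f x v.
Proof.
rewrite /jacobian_apply; move: (partial 0 f x) (partial 1 f x) => P Q.
by rewrite !mxE scalerDr !scalerA.
Qed.

Lemma jacobian_apply_le f x v :
  `|jacobian_apply f x v| <= (`|partial 0 f x| + `|partial 1 f x|) * `|v|.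
Proof.
rewrite /jacobian_apply; move: (partial 0 f x) (partial 1 f x) => P Q.
apply: (le_trans (ler_normD _ _)); rewrite !normrZ mulrDl; apply: lerD; rewrite mulrC;
  by apply: ler_wpM2l => //; exact: coord_norm_le.
Qed.

Lemma has_deriv_chain f (g : R -> plane) t v : smooth f ->
  has_deriv g t v -> has_deriv (fun s => f (g s)) t (jacobian_apply f (g t) v).
Proof.
move=> sf gv e e0; have [K K0 HK] := smooth_taylor (`|g t| + 1) sf.
set C := `|partial 0 f (g t)| + `|partial 1 f (g t)|.
have C0 : 0 <= C by rewrite addr_ge0.
pose e1 := Num.min 1 (e / 2 / (C + 1)).
have C1 : 0 < C + 1 by lra.
have e10 : 0 < e1 by rewrite lt_min ltr01 !divr_gt0.
have [d d0 Hd] := gv e1 e10.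
set V := `|v| + 1; have V0 : 0 < V by rewrite /V ltr_wpDl.
have KV0 : 0 < K * V ^+ 2 by rewrite mulr_gt0 // exprn_gt0.
exists (Num.min d (Num.min (V^-1) (e / 2 / (K * V ^+ 2)))).
  by rewrite !lt_min d0 invr_gt0 V0 !divr_gt0.
move=> s; rewrite !lt_min => /andP[sd /andP[sV se]].
have h := Hd s sd; set r := `|s - t| in sd sV se h *.
have r0 : 0 <= r by exact: normr_ge0.
have gst : `|g s - g t| <= V * r.
  have -> : g s - g t = (g s - g t - (s - t) *: v) + (s - t) *: v by rewrite subrK.
  apply: (le_trans (ler_normD _ _)); rewrite normrZ /V mulrDl mul1r addrC.
  apply: lerD; first by rewrite mulrC.
  by apply: (le_trans h); rewrite -[leRHS]mul1r ler_wpM2r // /e1 ge_min lexx.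
have gs1 : `|g s| <= `|g t| + 1.
  have -> : g s = g t + (g s - g t) by rewrite addrC subrK.
  apply: (le_trans (ler_normD _ _)); apply: lerD => //; apply: (le_trans gst).
  by rewrite mulrC -ler_pdivlMr // div1r ltW.
have -> : f (g s) - f (g t) - (s - t) *: jacobian_apply f (g t) v =
   (f (g s) - f (g t) - jacobian_apply f (g t) (g s - g t)) +
   jacobian_apply f (g t) (g s - g t - (s - t) *: v).
  rewrite [jacobian_apply f (g t) (_ - _ *: _)]jacobian_applyD -[in RHS]scaleNr.
  by rewrite jacobian_applyZ addrA subrK scaleNr.
apply: (le_trans (ler_normD _ _)).
have -> : e * r = e / 2 * r + e / 2 * r by lra.
apply: lerD.
  apply: (le_trans (HK _ _ _ gs1)); first by rewrite lerDl.
  have : `|g s - g t| ^+ 2 <= (V * r) ^+ 2 by rewrite ler_pXn2r // nnegrE // mulr_ge0 // ltW.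
  rewrite -(ler_pM2l K0) => /le_trans; apply.
  rewrite exprMn mulrA [r ^+ 2]expr2 mulrA ler_wpM2r // mulrC.
  by rewrite -ler_pdivlMr // ltW.
apply: (le_trans (jacobian_apply_le _ _ _)); rewrite -/C.
apply: (@le_trans _ _ (C * (e1 * r))); first exact: ler_wpM2l.
rewrite mulrA ler_wpM2r //; apply: (@le_trans _ _ ((C + 1) * e1)).
  by rewrite ler_wpM2r // ltW // ltrDl.
by rewrite mulrC -ler_pdivlMr // /e1 ge_min lexx orbT.
Qed.

(** The projection onto the box of radius [M] is [1]-Lipschitz for the supremum
norm; composing a field with it truncates the field without destroying its
Lipschitz continuity. *)
Definition clamp (M : R) (x : plane) : plane :=
  \row_i Num.max (- M) (Num.min M (x 0 i)).

Lemma clamp_norm M x : 0 <= M -> `|clamp M x| <= M.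
Proof.
move=> M0; apply/row_norm_le => // i; rewrite mxE ler_norml; apply/andP; split.
  by rewrite le_max lexx.
by rewrite ge_max ge_min lexx; lra.
Qed.

Lemma clamp_id M x : `|x| <= M -> clamp M x = x.
Proof.
move=> xM; apply/rowP => i; rewrite mxE; have := le_trans (coord_norm_le x i) xM.
by rewrite ler_norml => /andP[h1 h2]; rewrite (min_idPr h2) (max_idPr h1).
Qed.

Lemma clamp_lipschitz M x y : 0 <= M -> `|clamp M x - clamp M y| <= `|x - y|.
Proof.
move=> M0; apply/row_norm_le => // i; rewrite !mxE.
have := coord_norm_le (x - y) i; rewrite !mxE; apply: le_trans.
have cP r : let c := Num.max (- M) (Num.min M r) in
    [\/ r <= - M /\ c = - M, - M <= r <= M /\ c = r | M <= r /\ c = M].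
  move=> c; rewrite /c; have [Mr|rM] := leP M r.
    by constructor 3; split => //; apply/max_idPr; lra.
  have [Nr|rN] := leP (- M) r; first by constructor 2; rewrite (ltW rM).
  by constructor 1; rewrite (ltW rN).
rewrite ler_norml; have := cP (x 0 i); have := cP (y 0 i).
set a := Num.max _ _; set b := Num.max _ _.
have := ler_norm (y 0 i - x 0 i); rewrite distrC.
have := ler_norm (x 0 i - y 0 i); set d := `|_|.
by move=> d1 d2 [] [h1 h2] [] [h3 h4]; apply/andP; split; lra.
Qed.

Lemma truncation_lipschitz X (M : R) : 0 <= M -> smooth X -> exists L K, [/\ 0 < L, 0 < K,
  forall x y, `|X (clamp M x) - X (clamp M y)| <= L * `|x - y| &
  forall x, `|X (clamp M x)| <= K].
Proof.
move=> M0 sX; have [L L0 HL] := smooth_lipschitz M sX.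
have [K K0 HK] := continuous_box_bounded M (smooth_continuous sX).
exists L, K; split => // [x y|x]; last exact/HK/clamp_norm.
apply: le_trans (HL _ _ (clamp_norm _ M0) (clamp_norm _ M0)) _.
by rewrite ler_pM2l //; exact: clamp_lipschitz.
Qed.

Lemma lipschitz_absolutely_continuous (V : normedModType R) (K a b : R) (g : R -> V) :
  lipschitz_between K a b g -> absolutely_continuous_between a b g.
Proof.
move=> gK e e0; have K1 : 0 < `|K| + 1 by rewrite ltr_wpDl.
exists (e / (`|K| + 1)); first by rewrite divr_gt0.
move=> n s t Hst _; rewrite ltr_pdivlMr // => h; apply: le_lt_trans h.
rewrite mulr_suml; apply: ler_sum => i _; have [a_s st tb] := Hst i.
apply: (le_trans (gK _ _ a_s st tb)); rewrite mulrC ler_wpM2l ?subr_ge0 //.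
by rewrite (le_trans (ler_norm K)) // lerDl.
Qed.

(** With a continuous right-hand side a Caratheodory solution is a classical one:
near [t] the curve [q s - s w t] is Lipschitz with an arbitrarily small
constant. *)
Lemma ae_derive_to_everywhere (N : set R) (K c : R) (q w : R -> plane) :
  (forall a b, lipschitz_between K a b q) -> mu.-negligible N -> continuous w ->
  (forall t, c < t -> ~ N t -> has_deriv q t (w t)) ->
  forall t, c < t -> has_deriv q t (w t).
Proof.
move=> qK N0 cw H t ct e e0.
have /cvgrPdist_le/(_ e e0)[d /= d0 Hd] := cw t.
exists (Num.min d (t - c)); first by rewrite lt_min d0 subr_gt0.
pose h s := q s - s *: w t.
have hd s v : has_deriv q s v -> has_deriv h s (v - w t).
  move=> qv; apply: has_derivB => // e' e'0; exists 1 => // r _.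
  by rewrite -scalerBl subrr normr0 mulr_ge0 // ltW.
have hL a b : t - d < a -> b < t + d -> c < a -> lipschitz_between e a b h.
  move=> ta bt ca; apply: (ae_derive_bounded_lipschitz (ltW e0) (N := N)) => //.
    apply: (@lipschitz_absolutely_continuous _ (K + `|w t|)) => s r a_s sr rb.
    have -> : h r - h s = (q r - q s) - (r - s) *: w t.
      by rewrite /h scalerBl !opprB addrACA [RHS]addrACA; congr (_ + _); rewrite addrC.
    apply: (le_trans (ler_normB _ _)); rewrite mulrDl normrZ.
    by rewrite [`|r - s|]ger0_norm ?subr_ge0 // [(r - s) * _]mulrC lerD2r; exact: (qK a b).
  move=> s /andP[a_s sb] nN; exists (w s - w t); last first.
    by apply: hd; apply: H => //; exact: lt_trans a_s.
  rewrite distrC; apply: Hd; rewrite /ball /= ltr_norml; lra.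
move=> s; rewrite lt_min => /andP[sd sc].
have -> : q s - q t - (s - t) *: w t = h s - h t.
  by rewrite /h scalerBl !opprB addrACA [RHS]addrACA; congr (_ + _); rewrite addrC.
move: sd sc; rewrite !ltr_norml => sd sc; have [ts|st] := leP t s.
  rewrite (ger0_norm (x := s - t)) ?subr_ge0 //.
  by apply: (hL t s) => //; lra.
rewrite [`|h s - h t|]distrC (ltr0_norm (x := s - t)) ?subr_lt0 // [- (s - t)]opprB.
by apply: (hL s t) => //; lra.
Qed.

Lemma local_integral_curve X p : smooth X ->
  exists (a b : \bar R) g, integral_curve X a b g /\ g 0 = p.
Proof.
move=> sX; pose M := `|p| + 1; have M0 : 0 <= M by rewrite addr_ge0.
have [L [K [L0 K0 HL HK]]] := truncation_lipschitz M0 sX.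
have v01 : R -> 0 <= (1 : R) <= 1 by move=> ?; apply/andP; split; [exact: ler01 | exact: lexx].
pose C x := X (clamp M x).
have mv : measurable_fun setT (fun _ : R => 1 : R) by exact: measurable_cst.
have [q [q0 qK [N N0 qd]]] := @caratheodory_existence R C C L K _ p L0 HL HK HL HK mv v01.
have cq := lipschitz_continuous qK; clear v01 mv.
have cw : continuous (fun t => X (clamp M (q t))).
  apply: (@lipschitz_continuous _ _ (L * K)) => a b s t a_s st tb.
  by apply: (le_trans (HL _ _)); rewrite -mulrA ler_pM2l //; exact: (qK a b).
have qd' : forall t, -1 < t -> has_deriv q t (X (clamp M (q t))).
  apply: (ae_derive_to_everywhere qK N0 cw) => t t1 nN.
  by have := qd t t1 nN; rewrite scale1r subrr scale0r addr0.
have K1 : 0 < K + 1 by exact: addr_gt0.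
(* During a time [1 / (K + 1)] the solution cannot leave the unit ball around
   [p], inside which the truncation is the identity. *)
pose d := Num.min 1 (K + 1)^-1; have d0 : 0 < d by rewrite lt_min ltr01 invr_gt0.
exists (- d)%:E, d%:E, q; split => //; split; rewrite ?lte_fin ?oppr_lt0 //.
move=> t; rewrite !lte_fin => t1 t2; apply/is_deriveP.
have dK : d * K <= 1.
  apply: (@le_trans _ _ ((K + 1)^-1 * (K + 1))); last by rewrite mulVf // gt_eqF.
  apply: ler_pM => //; [exact: ltW|exact: ltW|by rewrite ge_min lexx orbT|by rewrite lerDl].
have qM : `|q t| <= M.
  rewrite -[q t](subrK p) addrC; apply: (le_trans (ler_normD _ _)); rewrite lerD2l.
  apply: le_trans dK; rewrite mulrC -q0; have [t0|t0] := leP 0 t.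
    apply: (le_trans (qK 0 t 0 t (lexx _) t0 (lexx _))); rewrite ler_pM2l // ; lra.
  rewrite distrC; apply: (le_trans (qK t 0 t 0 (lexx _) (ltW t0) (lexx _))).
  by rewrite ler_pM2l //; lra.
have := qd' t; rewrite (clamp_id qM); apply.
by have : d <= 1 by [rewrite ge_min lexx]; lra.
Qed.
End smooth_fields.

(** * Integral curves and asymptotically stable fields *)

Section integral_curves.
Context {R : realType}.
Local Notation mu := (@lebesgue_measure R).
Local Notation plane := 'rV[R]_2.
Implicit Types (X : plane -> plane) (g : R -> plane) (p : plane).

Lemma segment_bounded (V : normedModType R) (f : R -> V) (a b : R) :
  (forall t, a <= t <= b -> {for t, continuous f}) ->
  exists2 M, 0 < M & forall t, a <= t <= b -> `|f t| <= M.
Proof.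
move=> cf; have cfM : {within `[a, b], continuous f}.
  by apply: continuous_in_subspaceT => t /set_mem /=; rewrite in_itv; exact: cf.
have /compact_bounded[K [_ HK]] := continuous_compact cfM (@segment_compact R a b).
exists (`|K| + 1); first by rewrite ltr_wpDl.
move=> t tab; apply: (HK (`|K| + 1)); last by exists t => //=; rewrite in_itv.
by rewrite (le_lt_trans (ler_norm K)) // ltrDl.
Qed.

(** The cut-off at height [eta] makes the differential inequality, known only
while [f] is below [eta], available everywhere. *)
Lemma trapped_gronwall (N : set R) (K L c eta a b : R) (f : R -> R) : a <= b ->
  0 <= L -> 0 <= c -> 0 < eta -> (forall t, a <= t <= b -> 0 <= f t) ->
  lipschitz_between K a b f -> mu.-negligible N ->
  (forall t, a < t < b -> ~ N t -> f t < eta -> right_dini_le f t (L * f t + c)) ->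
  (f a + c * (b - a)) * expR (L * (b - a)) < eta ->
  f b <= (f a + c * (b - a)) * expR (L * (b - a)).
Proof.
move=> ab L0 c0 eta0 f0 fK N0 Hf fa.
pose F t := Num.min (f t) eta.
have Ff t : F t <= f t by rewrite /F ge_min lexx.
have Feta t : F t <= eta by rewrite /F ge_min lexx orbT.
have FL : lipschitz_between K a b F.
  move=> s t a_s st tb; apply: le_trans (fK s t a_s st tb).
  have := ler_norm (f t - f s); have := ler_norm (f s - f t).
  rewrite distrC ler_norml /F; set d := `|_| => h1 h2.
  have := normr_ge0 (f t - f s); rewrite -/d => d0.
  have [?|?] := leP (f t) eta; have [?|?] := leP (f s) eta; apply/andP; split; lra.
have FbFa : F b <= (F a + c * (b - a)) * expR (L * (b - a)).
  apply: (gronwall_dini (N := N) ab L0 c0 _ FL N0) => [t tab|t tab nN].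
    by rewrite le_min f0 //= ltW.
  have f0t : 0 <= f t by case/andP: tab => ? ?; apply: f0; rewrite !ltW.
  have [fe|ef] := ltP (f t) eta; last first.
    move=> e e0; exists 1 => // s ts _.
    have Ft : F t = eta by rewrite /F (min_idPr ef).
    apply: (@le_trans _ _ 0); first by rewrite Ft subr_le0.
    apply: mulr_ge0; last by rewrite subr_ge0.
    by rewrite !addr_ge0 ?(ltW e0) // Ft mulr_ge0 // ltW.
  have Ft : F t = f t by rewrite /F (min_idPl (ltW fe)).
  move=> e e0; have [d d0 Hd] := Hf t tab nN fe e e0; exists d => // s ts sd.
  by rewrite Ft; apply: le_trans (Hd s ts sd); rewrite lerD2r.
have Fb : F b <= (f a + c * (b - a)) * expR (L * (b - a)).
  by apply: (le_trans FbFa); rewrite ler_wpM2r ?expR_ge0 // lerD2r.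
have [fbe|efb] := leP (f b) eta; first by move: Fb; rewrite /F (min_idPl fbe).
by move: Fb; rewrite /F (min_idPr (ltW efb)) leNgt fa.
Qed.

(** Only [g1] is assumed to stay in a bounded region: while it is within distance
[1] of [g1], the curve [g2] sees the same Lipschitz constant, and
[trapped_gronwall] shows that it remains so. *)
Lemma curve_dependence X (M L a b : R) (g1 g2 : R -> plane) : a <= b -> 0 <= L ->
  continuous X ->
  (forall x y, `|x| <= M + 1 -> `|y| <= M + 1 -> `|X x - X y| <= L * `|x - y|) ->
  (forall t, a <= t <= b -> has_deriv g1 t (X (g1 t)) /\ `|g1 t| <= M) ->
  (forall t, a <= t <= b -> has_deriv g2 t (X (g2 t))) ->
  `|g1 a - g2 a| * expR (L * (b - a)) < 1 ->
  `|g1 b - g2 b| <= `|g1 a - g2 a| * expR (L * (b - a)).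
Proof.
move=> ab L0 cX HL H1 H2 small.
have hd t : a <= t <= b -> has_deriv (fun s => g1 s - g2 s) t (X (g1 t) - X (g2 t)).
  by move=> tab; apply: has_derivB; [case: (H1 t tab)|exact: H2].
have [K K0 HK] : exists2 K, 0 < K & forall t, a <= t <= b -> `|X (g1 t) - X (g2 t)| <= K.
  apply: (@segment_bounded _ (fun t => X (g1 t) - X (g2 t))) => t tab.
  apply: cvgB; apply: (continuous_comp _ (cX _)).
    by have [h _] := H1 t tab; exact: has_deriv_continuous h.
  exact: has_deriv_continuous (H2 t tab).
have hK : lipschitz_between K a b (fun s => g1 s - g2 s).
  apply: everywhere_derive_bounded_lipschitz; first exact: ltW.
  by move=> t tab; exists (X (g1 t) - X (g2 t)); [exact: HK|exact: hd].
have := @trapped_gronwall set0 K L 0 1 a b (fun s => `|g1 s - g2 s|) ab L0 (lexx 0).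
rewrite mul0r addr0; apply => //.
- exact: lipschitz_between_norm.
- exact: negligible_set0.
move=> t /andP[at_ tb] _ h1; have tab : a <= t <= b by rewrite !ltW.
rewrite addr0; apply: has_deriv_norm_dini (hd t tab) _; have [_ g1M] := H1 t tab.
apply: HL; first by apply: (le_trans g1M); rewrite lerDl.
have -> : g2 t = g1 t - (g1 t - g2 t) by rewrite opprB addrC subrK.
by apply: (le_trans (ler_normB _ _)); apply: lerD => //; exact: ltW.
Qed.

(** Backward uniqueness is forward uniqueness for the opposite field. *)
Lemma curve_uniqueness X (a b : R) (g1 g2 : R -> plane) : a <= b -> smooth X ->
  (forall t, a <= t <= b -> has_deriv g1 t (X (g1 t))) ->
  (forall t, a <= t <= b -> has_deriv g2 t (X (g2 t))) ->
  (g1 a = g2 a -> g1 b = g2 b) /\ (g1 b = g2 b -> g1 a = g2 a).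
Proof.
move=> ab sX H1 H2; have cX := smooth_continuous sX.
have [M M0 HM] : exists2 M, 0 < M & forall t, a <= t <= b -> `|g1 t| <= M.
  by apply: segment_bounded => t /H1; exact: has_deriv_continuous.
have [L L0 HL] := smooth_lipschitz (M + 1) sX.
split=> E; apply/eqP; rewrite -subr_eq0 -normr_le0.
  have := @curve_dependence X M L a b g1 g2 ab (ltW L0) cX HL _ H2.
  rewrite E subrr normr0 mul0r; apply; last exact: ltr01.
  by move=> t tab; split; [exact: H1|exact: HM].
have rev (g : R -> plane) : (forall t, a <= t <= b -> has_deriv g t (X (g t))) ->
    forall t, - b <= t <= - a -> has_deriv (fun s => g (- s)) t (- X (g (- t))).
  move=> Hg t /andP[bt ta] e e0; have tab : a <= - t <= b by apply/andP; split; lra.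
  have [d d0 Hd] := Hg (- t) tab e e0; exists d => // s sd.
  have e1 : - s - - t = - (s - t) by rewrite opprB opprK addrC.
  by have := Hd (- s); rewrite e1 normrN scaleNr scalerN => /(_ sd).
have := @curve_dependence (fun x => - X x) M L (- b) (- a) (fun s => g1 (- s)) (fun s => g2 (- s)).
rewrite !opprK E subrr normr0 mul0r; apply; [by rewrite lerN2|exact: ltW| | | | |exact: ltr01].
- by move=> x; have h := cX x; exact: (cvgN h).
- by move=> x y xM yM; rewrite -opprD normrN; exact: HL.
- move=> t tab; split; first exact: (rev _ H1).
  by apply: HM; case/andP: tab => ? ?; apply/andP; split; lra.
- exact: (rev _ H2).
Qed.

Lemma integral_curve_uniqueness X (a1 b1 a2 b2 : \bar R) g1 g2 (t : R) : smooth X ->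
  integral_curve X a1 b1 g1 -> integral_curve X a2 b2 g2 -> g1 0 = g2 0 ->
  (a1 < t%:E)%E -> (t%:E < b1)%E -> (a2 < t%:E)%E -> (t%:E < b2)%E -> g1 t = g2 t.
Proof.
move=> sX [a10 b10 H1] [a20 b20 H2] E a1t tb1 a2t tb2.
have [t0|t0] := leP 0 t.
  have [||h _] := @curve_uniqueness X 0 t g1 g2 t0 sX; last exact: h.
    move=> s /andP[s0 st]; apply/is_deriveP; apply: H1.
      by apply: (lt_le_trans a10); rewrite lee_fin.
    by apply: le_lt_trans tb1; rewrite lee_fin.
  move=> s /andP[s0 st]; apply/is_deriveP; apply: H2.
    by apply: (lt_le_trans a20); rewrite lee_fin.
  by apply: le_lt_trans tb2; rewrite lee_fin.
have [||_ h] := @curve_uniqueness X t 0 g1 g2 (ltW t0) sX; last exact: h.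
  move=> s /andP[ts s0]; apply/is_deriveP; apply: H1.
    by apply: (lt_le_trans a1t); rewrite lee_fin.
  by apply: le_lt_trans b10; rewrite lee_fin.
move=> s /andP[ts s0]; apply/is_deriveP; apply: H2.
  by apply: (lt_le_trans a2t); rewrite lee_fin.
by apply: le_lt_trans b20; rewrite lee_fin.
Qed.

Lemma ereal_gap (a b : \bar R) (t : R) : (a < t%:E)%E -> (t%:E < b)%E ->
  exists2 d, 0 < d & forall s, `|s - t| < d -> (a < s%:E)%E /\ (s%:E < b)%E.
Proof.
move=> at_ tb.
have [d1 d10 H1] : exists2 d, 0 < d & forall s, `|s - t| < d -> (a < s%:E)%E.
  case: a at_ => [a|//|_]; last by exists 1 => // s _; rewrite ltNyr.
  rewrite lte_fin => at_; exists (t - a); first by rewrite subr_gt0.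
  by move=> s; rewrite lte_fin ltr_norml; lra.
have [d2 d20 H2] : exists2 d, 0 < d & forall s, `|s - t| < d -> (s%:E < b)%E.
  case: b tb => [b|_|//]; last by exists 1 => // s _; rewrite ltry.
  rewrite lte_fin => tb; exists (b - t); first by rewrite subr_gt0.
  by move=> s; rewrite lte_fin ltr_norml; lra.
exists (Num.min d1 d2); first by rewrite lt_min d10.
by move=> s; rewrite lt_min => /andP[h1 h2]; split; [exact: H1|exact: H2].
Qed.

Lemma has_deriv_near (V : normedModType R) (f h : R -> V) t v d : 0 < d ->
  (forall s, `|s - t| < d -> f s = h s) -> has_deriv h t v -> has_deriv f t v.
Proof.
move=> d0 E H e e0; have [d' d'0 Hd] := H e e0; exists (Num.min d d').
  by rewrite lt_min d0.
move=> s; rewrite lt_min => /andP[h1 h2]; rewrite !E //; first exact: Hd.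
by rewrite subrr normr0.
Qed.

(** The maximal curve through [p] is the union of all the integral curves
through [p]; they agree on overlaps by uniqueness. *)
Lemma maximal_curve_exists X p : smooth X ->
  exists (a b : \bar R) g, maximal_integral_curve X a b g /\ g 0 = p.
Proof.
move=> sX.
pose S (c : \bar R * \bar R * (R -> plane)) := integral_curve X c.1.1 c.1.2 c.2 /\ c.2 0 = p.
have [a0 [b0 [g0 S0]]] := local_integral_curve p sX.
have {}S0 : S (a0, b0, g0) by [].
pose A := [set c.1.1 | c in S]; pose B := [set c.1.2 | c in S].
pose at_time t c := [/\ S c, (c.1.1 < t%:E)%E & (t%:E < c.1.2)%E].
have /choice[G GP] : forall t, exists x, forall c, at_time t c -> c.2 t = x.
  move=> t; have [[c ct]|nc] := pselect (exists c, at_time t c); last first.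
    by exists 0 => c ct; case: nc; exists c.
  exists (c.2 t) => c' [[Sc' E'] h1 h2]; have [[Sc E] h3 h4] := ct.
  by apply: (integral_curve_uniqueness sX Sc' Sc) => //; rewrite E E'.
have cover t : (ereal_inf A < t%:E)%E -> (t%:E < ereal_sup B)%E -> exists c, at_time t c.
  move=> At tB; have [t0|t0] := leP 0 t.
    have [_ [c Sc <-] tc] := ereal_sup_gt tB.
    exists c; split => //; have [[c0 _ _] _] := Sc.
    by apply: (lt_le_trans c0); rewrite lee_fin.
  have [_ [c Sc <-] tc] := ereal_inf_lt At.
  exists c; split => //; have [[_ c0 _] _] := Sc.
  by apply: le_lt_trans c0; rewrite lee_fin ltW.
have A0 : (ereal_inf A < 0)%E.
  have [[a00 _ _] _] := S0; apply: le_lt_trans a00.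
  by apply: ereal_inf_lbound; exists (a0, b0, g0).
have B0 : (0 < ereal_sup B)%E.
  have [[_ b00 _] _] := S0; apply: (lt_le_trans b00).
  by apply: ereal_sup_ubound; exists (a0, b0, g0).
have G0 : G 0 = p.
  by have [[a00 b00 _] E] := S0; rewrite -(GP 0 (a0, b0, g0)).
exists (ereal_inf A), (ereal_sup B), G; split => //; split.
  split => // t At tB; have [c ct] := cover t At tB; have [Sc h1 h2] := ct.
  have [d d0 Hd] := ereal_gap h1 h2; apply/is_deriveP.
  have [[_ _ Hc] _] := Sc.
  rewrite -(GP t c ct); apply: (has_deriv_near d0 (h := c.2)).
    by move=> s /Hd[h3 h4]; rewrite (GP s c).
  exact/is_deriveP/Hc.
move=> a' b' g' aa bb Hg' E.
have Sg : S (a', b', g') by split => //=; rewrite E.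
split; apply/le_anti; rewrite ?aa ?bb ?andbT /=.
  by apply: ereal_inf_lbound; exists (a', b', g').
by apply: ereal_sup_ubound; exists (a', b', g').
Qed.

(** The curve is required to be defined a little before time [0], so that its
derivative at [0] is two-sided and that every positive shift is again such an
orbit. *)
Definition forward_orbit X g :=
  exists2 a, a < 0 & forall t, a < t -> has_deriv g t (X (g t)).

Lemma forward_orbit_curve X g : forward_orbit X g ->
  exists2 a : R, a < 0 & integral_curve X a%:E +oo%E g.
Proof.
move=> [a a0 H]; exists a => //; split; rewrite ?ltry ?lte_fin // => t.
by rewrite lte_fin => at_ _; apply/is_deriveP; exact: H.
Qed.

Lemma forward_orbit_shift X g t0 : 0 <= t0 -> forward_orbit X g ->
  forward_orbit X (fun s => g (s + t0)).
Proof.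
move=> t00 [a a0 H]; exists a => // t at_ e e0.
have [d d0 Hd] := H (t + t0) ltac:(lra) e e0; exists d => // s sd.
have e1 : s + t0 - (t + t0) = s - t by ring.
by have := Hd (s + t0); rewrite e1; exact.
Qed.

Section asymptotically_stable.
Variable X : plane -> plane.
Hypotheses (sX : smooth X) (gasX : globally_asymptotically_stable X).

Lemma forward_orbit_exists p : exists g,
  [/\ forward_orbit X g, g 0 = p & g t @[t --> +oo] --> (0 : plane)].
Proof.
have [a [b [g [mg g0]]]] := maximal_curve_exists p sX.
have [_ _ /(_ a b g mg)[b_oo cg]] := gasX.
have [[a0 _ Hg] _] := mg; exists g; split => //.
have [d d0 Hd] := ereal_gap a0 (ltry 0).
exists (- (d / 2)); first by rewrite oppr_lt0 divr_gt0.
move=> t dt; apply/is_deriveP/Hg; last by rewrite b_oo ltry.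
have [] := Hd (- (d / 2)); first by rewrite subr0 normrN gtr0_norm; lra.
by move=> h _; apply: (lt_trans h); rewrite lte_fin.
Qed.

Lemma forward_orbit_stable e : 0 < e -> exists2 d, 0 < d &
  forall g, forward_orbit X g -> `|g 0| < d -> forall t, 0 <= t -> `|g t| < e.
Proof.
have [_ H _] := gasX; move=> /H[d d0 Hd]; exists d => // g.
move=> /forward_orbit_curve[a a0 Hg] g0 t t0.
by apply: (Hd _ _ _ Hg) => //; rewrite ltry.
Qed.

(** Every orbit issued from a given ball is eventually trapped in the ball of
radius [r]; by compactness one constant bounds both all these orbits and their
entrance times. *)
Lemma uniform_attraction (r rho : R) : 0 < r -> exists2 M, 0 < M &
  forall g, forward_orbit X g -> `|g 0| <= rho ->
    forall t, 0 <= t -> `|g t| <= M /\ (M <= t -> `|g t| <= r).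
Proof.
move=> r0.
(* [P] increases with [M], which makes it stable under finite covers. *)
pose P (M : R) (p : plane) := forall g, forward_orbit X g -> g 0 = p ->
  forall t, 0 <= t -> `|g t| <= M /\ (M <= t -> `|g t| <= r).
suff : \forall M \near +oo, [set x : plane | `|x| <= rho] `<=` P M.
  move=> [M0 [_ HM]]; exists (Num.max 1 (M0 + 1)); first by rewrite lt_max ltr01.
  move=> g og g0; apply: (HM (Num.max 1 (M0 + 1)) _ (g 0)) => //.
  by rewrite lt_max ltrDl ltr01 orbT.
apply: ((compact_near_coveringP _).1 (@box_compact R rho)) => p _.
have [d d0 Hd] := forward_orbit_stable r0.
have [phi [ophi phi0 cphi]] := forward_orbit_exists p.
have [T T0 phiT] : exists2 T, 0 <= T & `|phi T| <= d / 2.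
  move/cvgrPdist_le : cphi => /(_ (d / 2)) [|T [_ HT]]; first by rewrite divr_gt0.
  exists (`|T| + 1); first by rewrite addr_ge0.
  by have := HT (`|T| + 1); rewrite sub0r normrN; apply; rewrite (le_lt_trans (ler_norm T)) // ltrDl.
have [a a0 dphi] := ophi.
have [M M0 HM] : exists2 M, 0 < M & forall t, 0 <= t <= T -> `|phi t| <= M.
  apply: segment_bounded => t /andP[t0 _]; apply: has_deriv_continuous (dphi t _).
  exact: lt_le_trans t0.
have [L L0 HL] := smooth_lipschitz (M + 1) sX.
pose E := expR (L * T); have E0 : 0 < E by exact: expR_gt0.
(* An orbit starting within [eta] of [p] is, up to time [T], within [1 / 2] of
   [phi], hence bounded, and within [d / 4] of [phi T], hence trapped. *)
pose eta := Num.min (1 / 2) (d / 4) / E.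
have eta0 : 0 < eta by rewrite divr_gt0 // lt_min !divr_gt0.
have Q (g : R -> plane) : forward_orbit X g -> `|p - g 0| < eta -> forall M' : R, M + 1 + r + T < M' ->
    forall t, 0 <= t -> `|g t| <= M' /\ (M' <= t -> `|g t| <= r).
  move=> og pg M' MM'.
  have close t : 0 <= t <= T -> `|phi t - g t| <= Num.min (1 / 2) (d / 4).
    move=> /andP[t0 tT].
    have Et : expR (L * (t - 0)) <= E by rewrite subr0 ler_expR ler_pM2l.
    have h : `|phi 0 - g 0| * expR (L * (t - 0)) <= Num.min (1 / 2) (d / 4).
      rewrite phi0; apply: (@le_trans _ _ (eta * E)); last by rewrite divfK // gt_eqF.
      by apply: ler_pM; [exact: normr_ge0 | exact: expR_ge0 | exact: ltW | exact: Et].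
    apply: (le_trans _ h); apply: (@curve_dependence X M L 0 t phi g t0 (ltW L0)) => //.
    - exact: smooth_continuous.
    - move=> s /andP[s0 st]; split; last by apply: HM; rewrite s0 (le_trans st).
      exact/dphi/(lt_le_trans a0).
    - move=> s /andP[s0 st]; have [a' a'0 dg] := og; exact/dg/(lt_le_trans a'0).
    - apply: (le_lt_trans h); rewrite gt_min; apply/orP; left; lra.
  have gT : `|g T| < d.
    have -> : g T = phi T - (phi T - g T) by rewrite opprB addrC subrK.
    apply: (le_lt_trans (ler_normB _ _)); have := close T; rewrite T0 lexx => /(_ isT).
    by rewrite le_min => /andP[_ h]; lra.
  have after t : T <= t -> `|g t| <= r.
    move=> Tt; have := Hd _ (forward_orbit_shift T0 og); rewrite add0r => /(_ gT (t - T)).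
    by rewrite subrK subr_ge0 => /(_ Tt) /ltW.
  move=> t t0; split; last by move=> h; apply: after; lra.
  have [Tt|tT] := leP T t; first by apply: (le_trans (after t Tt)); lra.
  have -> : g t = phi t - (phi t - g t) by rewrite opprB addrC subrK.
  apply: (le_trans (ler_normB _ _)); have := close t; rewrite t0 (ltW tT) => /(_ isT).
  rewrite le_min => /andP[h _]; have := HM t; rewrite t0 (ltW tT) => /(_ isT); lra.
exists ([set x : plane | `|p - x| < eta], [set M' | M + 1 + r + T < M']).
  split; last by exists (M + 1 + r + T); split => //; exact: num_real.
  by apply/nbhs_ballP; exists eta => // x; rewrite -ball_normE.
move=> [x M'] /= [px MM'] g og g0; apply: (Q g og) => //.
by rewrite g0.
Qed.
End asymptotically_stable.
End integral_curves.

(** * Transport of a field along the flow of another *)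

Section moving_frame.
Context {R : realType}.
Local Notation mu := (@lebesgue_measure R).
Local Notation plane := 'rV[R]_2.
Implicit Types (X Y : plane -> plane) (g : R -> plane) (x y v w : plane).

Lemma has_deriv_of_coords g t v :
  (forall i, has_deriv (fun s => g s 0 i) t (v 0 i : R)) -> has_deriv g t v.
Proof.
move=> H; apply/is_deriveP.
have dg : derivable g t 1.
  by apply/derivable_mxP => i j; rewrite (ord1 i); have /is_deriveP[] := H j.
split=> //; rewrite derive_mx //; apply/rowP => j; rewrite mxE.
by have /is_deriveP[_ <-] := H j.
Qed.

Lemma has_deriv_scalev (m : R -> R) g t (m' : R) v :
  has_deriv m t m' -> has_deriv g t v ->
  has_deriv (fun s => m s *: g s) t (m t *: v + m' *: g t).
Proof.
move=> Hm Hg; apply: has_deriv_of_coords => i.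
rewrite (_ : (fun s => (m s *: g s) 0 i) = (fun s => m s * g s 0 i)); last first.
  by apply/funext => s; rewrite mxE.
have /is_deriveP h1 := Hm; have /is_deriveP h2 := has_deriv_coord i Hg.
apply/is_deriveP; have h := is_deriveM h1 h2.
by rewrite !mxE; move: h; rewrite /GRing.scale /= [_ * m']mulrC.
Qed.

(** The determinant of two vectors, whose nonvanishing makes them a frame. *)
Definition wedge v w : R := v 0 0 * w 0 1 - v 0 1 * w 0 0.

Lemma wedge_cramer v w z : wedge v w != 0 ->
  z = (wedge z w / wedge v w) *: v + (wedge v z / wedge v w) *: w.
Proof.
move=> vw; apply/rowP => i; rewrite !mxE.
case: (ord2_cases i) => ->; move: vw; rewrite /wedge => vw; field; exact: vw.
Qed.

Lemma continuous_coord (T : topologicalType) (f : T -> plane) (t : T) i :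
  {for t, continuous f} -> {for t, continuous (fun s => f s 0 i)}.
Proof.
move=> cf.
exact: (@continuous_comp _ _ _ f (fun v : plane => v 0 i) t cf (@coord_continuous _ _ _ 0 i _)).
Qed.

Lemma wedge_continuous (f g : plane -> plane) : continuous f -> continuous g ->
  continuous (fun x => wedge (f x) (g x)).
Proof.
move=> cf cg x; have f_ i := continuous_coord (i := i) (cf x).
have g_ i := continuous_coord (i := i) (cg x).
exact: (cvgB (cvgM (f_ 0) (g_ 1)) (cvgM (f_ 1) (g_ 0))).
Qed.

(** A continuous function on a segment is extended by constants before its
primitive is taken, so that two-sided derivatives exist at the end points. *)
Lemma segment_primitive (b : R) (e : R -> R) : 0 <= b ->
  (forall s, 0 <= s <= b -> {for s, continuous e}) ->
  exists E, E 0 = 0 /\ forall s, 0 <= s <= b -> has_deriv E s (e s).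
Proof.
move=> b0 ce; have [K K0 HK] := segment_bounded ce.
pose cl := segment_retract b.
have cl0b s : 0 <= cl s <= b := segment_retract_itv s b0.
have ccl : continuous cl := @segment_retract_continuous R b.
pose f s := e (cl s).
have cf : continuous f.
  by move=> s; apply: (continuous_comp (ccl s)); exact: ce.
pose w s : plane := const_mx (f s).
have wd s t : `|w s - w t| = `|f s - f t|.
  apply/le_anti/andP; split.
    by apply/row_norm_le => // i; rewrite !mxE.
  by have := coord_norm_le (w s - w t) 0; rewrite !mxE.
have cw : continuous w.
  move=> s; apply/cvgrPdist_le => r r0; have /cvgrPdist_le/(_ r r0) := cf s.
  by apply: filterS => t; rewrite wd.
have [|t|q [q0 qK [N N0 qd]]] := @plane_primitive R w K 0.
- by move=> i; rewrite (_ : (fun t => w t 0 i) = f);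
    [exact: continuous_measurable_fun | apply/funext => t; rewrite mxE].
- by apply/row_norm_le; [exact: ltW | move=> i; rewrite mxE; exact: HK].
exists (fun s => q s 0 0); split; first by rewrite q0 mxE.
move=> s sb; have s1 : -1 < s by case/andP: sb => ? _; lra.
have := has_deriv_coord 0 (ae_derive_to_everywhere qK N0 cw qd s1).
by rewrite mxE /f /cl segment_retract_id.
Qed.

(** [w] transports [Y] along the [X]-curve [g] by the linearised flow.  In the
moving frame [(X, Y)] the variational equation becomes triangular: writing
[DX Y - DY X = c X + e Y] and [w = mu X + nu Y], it reads [mu' = c nu] and
[nu' = e nu].  Hence [nu] is an exponential and never changes sign. *)
Lemma transported_field X Y g (b : R) : smooth X -> smooth Y -> 0 <= b ->
  (forall s, 0 <= s <= b -> has_deriv g s (X (g s))) ->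
  (forall s, 0 <= s <= b -> wedge (X (g s)) (Y (g s)) != 0) ->
  exists (w : R -> plane) (m nu : R), [/\ w 0 = Y (g 0),
    w b = m *: X (g b) + nu *: Y (g b), 0 < nu, b = 0 -> m = 0 &
    forall s, 0 <= s <= b -> has_deriv w s (jacobian_apply X (g s) (w s))].
Proof.
move=> sX sY b0 Hg Hw.
have cX := smooth_continuous sX; have cY := smooth_continuous sY.
pose Z x := jacobian_apply X x (Y x) - jacobian_apply Y x (X x).
have cJ (f h : plane -> plane) : smooth f -> continuous h ->
    continuous (fun x => jacobian_apply f x (h x)).
  move=> sf ch x; have h_ i := continuous_coord (i := i) (ch x).
  have p_ i : {for x, continuous (partial i f)} := smooth_continuous (smooth_partial i sf) (x := x).
  exact: (cvgD (cvgZ (h_ 0) (p_ 0)) (cvgZ (h_ 1) (p_ 1))).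
have cZ : continuous Z by move=> x; exact: (cvgB (cJ X Y sX cY x) (cJ Y X sY cX x)).
have cg s : 0 <= s <= b -> {for s, continuous g} by move=> /Hg; exact: has_deriv_continuous.
pose c0 x := wedge (Z x) (Y x) / wedge (X x) (Y x).
pose e0 x := wedge (X x) (Z x) / wedge (X x) (Y x).
have cq (f h : plane -> plane) s : 0 <= s <= b -> continuous f -> continuous h ->
    {for s, continuous (fun s => wedge (f (g s)) (h (g s)) / wedge (X (g s)) (Y (g s)))}.
  move=> sb cf ch; apply: (@cvgM _ _ _ _ (fun s => wedge (f (g s)) (h (g s)))).
    exact: (continuous_comp (cg s sb) (wedge_continuous cf ch (x := g s))).
  apply: cvgV; first exact: Hw.
  exact: (continuous_comp (cg s sb) (wedge_continuous cX cY (x := g s))).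
(* [nu = exp (primitive of e)], then [mu] is a primitive of [c nu]. *)
have [|E [E0 HE]] := @segment_primitive b (fun s => e0 (g s)) b0.
  by move=> s sb; exact: cq.
pose nu s := expR (E s).
have dnu s : 0 <= s <= b -> has_deriv nu s (e0 (g s) * nu s).
  move=> sb; apply/is_deriveP; rewrite mulrC; apply: is_derive1_comp.
  exact/is_deriveP/HE.
have [|m [m0 Hm]] := @segment_primitive b (fun s => c0 (g s) * nu s) b0.
  move=> s sb; apply: cvgM; first exact: cq.
  exact: has_deriv_continuous (dnu s sb).
exists (fun s => m s *: X (g s) + nu s *: Y (g s)), (m b), (nu b); split => //.
- by rewrite m0 /nu E0 expR0 scale0r add0r scale1r.
- exact: expR_gt0.
- by move=> ->.
move=> s sb.
have dXg := has_deriv_chain sX (Hg s sb); have dYg := has_deriv_chain sY (Hg s sb).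
have := has_derivD (has_deriv_scalev (Hm s sb) dXg) (has_deriv_scalev (dnu s sb) dYg).
have := wedge_cramer (Z (g s)) (Hw s sb); rewrite -/(c0 (g s)) -/(e0 (g s)).
rewrite jacobian_applyD !jacobian_applyZ /Z.
move: (X (g s)) (Y (g s)) (jacobian_apply X (g s) (X (g s)))
  (jacobian_apply X (g s) (Y (g s))) (jacobian_apply Y (g s) (X (g s)))
  (c0 (g s)) (e0 (g s)) => Xs Ys XX XY YX c e bracket.
suff -> : m s *: XX + nu s *: XY =
  m s *: XX + (c * nu s) *: Xs + (nu s *: YX + (e * nu s) *: Ys) by [].
have -> : XY = c *: Xs + e *: Ys + YX by rewrite -bracket subrK.
rewrite !scalerDr !scalerA [nu s * c]mulrC [nu s * e]mulrC -!addrA.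
by congr (_ + (_ + _)); rewrite addrC.
Qed.

Lemma orbit_second_order X g (M L S : R) (lo hi : R) :
  (forall x y, `|x| <= M -> `|y| <= M -> `|X x - X y| <= L * `|x - y|) ->
  (forall x, `|x| <= M -> `|X x| <= S) -> 0 <= L -> 0 <= S ->
  (forall t, lo <= t <= hi -> has_deriv g t (X (g t)) /\ `|g t| <= M) ->
  forall s t, lo <= s <= hi -> lo <= t <= hi ->
    `|g t - g s - (t - s) *: X (g s)| <= L * S * (t - s) ^+ 2.
Proof.
move=> HL HS L0 S0 H s t /andP[ls sh] /andP[lt_ th].
have gS : lipschitz_between S lo hi g.
  apply: everywhere_derive_bounded_lipschitz => // r rlh; exists (X (g r)).
    by apply: HS; case: (H r rlh).
  by case: (H r rlh).
pose h r := g r - r *: X (g s).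
have hd r : lo <= r <= hi -> has_deriv h r (X (g r) - X (g s)).
  move=> rlh; apply: has_derivB; first by case: (H r rlh).
  move=> e e0; exists 1 => // r' _.
  by rewrite -scalerBl subrr normr0 mulr_ge0 // ltW.
have gM : `|g s| <= M by have [] := H s ltac:(by rewrite ls).
have -> : g t - g s - (t - s) *: X (g s) = h t - h s.
  by rewrite /h scalerBl !opprB addrACA [RHS]addrACA; congr (_ + _); rewrite addrC.
have [st|ts] := leP s t.
  have hL : lipschitz_between (L * S * (t - s)) s t h.
    apply: everywhere_derive_bounded_lipschitz; first by rewrite !mulr_ge0 // subr_ge0.
    move=> r /andP[sr rt]; have rlh : lo <= r <= hi by rewrite (le_trans ls) //= (le_trans rt).
    exists (X (g r) - X (g s)); last exact: hd.
    apply: (le_trans (HL _ _ (H r rlh).2 gM)); rewrite -mulrA ler_wpM2l //.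
    apply: (le_trans (gS s r ls sr (le_trans rt th))); rewrite ler_wpM2l //; lra.
  by apply: (le_trans (hL s t (lexx _) st (lexx _))); rewrite -mulrA -expr2.
have hL : lipschitz_between (L * S * (s - t)) t s h.
  apply: everywhere_derive_bounded_lipschitz; first by rewrite !mulr_ge0 // subr_ge0 ltW.
  move=> r /andP[tr rs]; have rlh : lo <= r <= hi by rewrite (le_trans lt_) //= (le_trans rs).
  exists (X (g r) - X (g s)); last exact: hd.
  apply: (le_trans (HL _ _ (H r rlh).2 gM)); rewrite -mulrA ler_wpM2l // distrC.
  apply: (le_trans (gS r s _ rs sh)); first exact: le_trans tr.
  by rewrite ler_wpM2l //; lra.
rewrite distrC; apply: (le_trans (hL t s (lexx _) (ltW ts) (lexx _))).
by rewrite -mulrA -expr2 -(sqrrN (s - t)) opprB.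
Qed.

(** Differentiability of the flow in the direction [w 0]: the curve [g + k w]
solves the equation of [X] up to an error of order [k ^ 2], so Gronwall's
inequality compares it with the true orbit [g']. *)
Lemma flow_first_order X g (w : R -> plane) (b A : R) : smooth X -> 0 <= b -> 0 <= A ->
  (forall s, 0 <= s <= b -> has_deriv g s (X (g s))) ->
  (forall s, 0 <= s <= b -> has_deriv w s (jacobian_apply X (g s) (w s))) ->
  exists C k0 : R, [/\ 0 <= C, 0 < k0 & forall k (g' : R -> plane), 0 <= k <= k0 ->
    (forall s, 0 <= s <= b -> has_deriv g' s (X (g' s))) ->
    `|g' 0 - g 0 - k *: w 0| <= A * k ^+ 2 ->
    `|g' b - g b - k *: w b| <= C * k ^+ 2].
Proof.
move=> sX b0 A0 Hg Hw; have cX := smooth_continuous sX.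
have [M1 M10 gM1] : exists2 M, 0 < M & forall s, 0 <= s <= b -> `|g s| <= M.
  by apply: segment_bounded => s /Hg; exact: has_deriv_continuous.
have [M2 M20 wM2] : exists2 M, 0 < M & forall s, 0 <= s <= b -> `|w s| <= M.
  by apply: segment_bounded => s /Hw; exact: has_deriv_continuous.
have [L L0 HL] := smooth_lipschitz (M1 + 1) sX.
have [K K0 HK] := smooth_taylor (M1 + 1) sX.
pose C := (A + K * M2 ^+ 2 * b) * expR (L * b).
have KM0 : 0 < K * M2 ^+ 2 by rewrite mulr_gt0 // exprn_gt0.
have C0 : 0 <= C by rewrite mulr_ge0 ?expR_ge0 // addr_ge0 // mulr_ge0 // ltW.
pose k0 := Num.min 1 (Num.min (1 / 2 / M2) (1 / 4 / (C + 1))).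
have C1 : 0 < C + 1 by rewrite ltr_wpDl.
exists C, k0; split => //; first by rewrite !lt_min ltr01 !divr_gt0.
move=> k g' /andP[k_ge0]; rewrite !le_min => /andP[k1 /andP[kM kC]] Hg' start.
have kM2 : k * M2 <= 1 / 2 by rewrite -ler_pdivlMr.
have kC2 : C * k ^+ 2 < 1 / 2.
  have kC' : k * (C + 1) <= 1 / 4 by rewrite -ler_pdivlMr.
  have : C * k ^+ 2 <= k * (C + 1).
    rewrite expr2 mulrA [X in X * _]mulrC -mulrA ler_wpM2l //.
    have : C * k <= C * 1 by exact: ler_wpM2l.
    lra.
  lra.
pose Q s := g s + k *: w s.
have dQ s : 0 <= s <= b -> has_deriv Q s (X (g s) + k *: jacobian_apply X (g s) (w s)).
  move=> sb; apply: has_derivD; first exact: Hg.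
  have := has_deriv_scalev (m := fun=> k) (m' := 0) _ (Hw s sb).
  by rewrite scale0r addr0; apply => e e0; exists 1 => // r _;
    rewrite subrr scaler0 subr0 normr0 mulr_ge0 // ltW.
have QM s : 0 <= s <= b -> `|Q s| <= M1 + 1 / 2.
  move=> sb; apply: (le_trans (ler_normD _ _)); apply: lerD; first exact: gM1.
  rewrite normrZ ger0_norm //; apply: le_trans kM2; rewrite ler_wpM2l //; exact: wM2.
have hd s : 0 <= s <= b -> has_deriv (fun s => g' s - Q s) s
    (X (g' s) - (X (g s) + k *: jacobian_apply X (g s) (w s))).
  by move=> sb; apply: has_derivB; [exact: Hg'|exact: dQ].
have [K' K'0 HK'] : exists2 K, 0 < K & forall s, 0 <= s <= b ->
    `|X (g' s) - (X (g s) + k *: jacobian_apply X (g s) (w s))| <= K.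
  have [K1 K10 HK1] : exists2 K, 0 < K & forall s, 0 <= s <= b -> `|X (g' s)| <= K.
    apply: (@segment_bounded _ _ (fun s => X (g' s))) => s sb.
    exact: (continuous_comp (has_deriv_continuous (Hg' s sb)) (cX _)).
  have [K2 K20 HK2] := continuous_box_bounded M1 cX.
  have [P0 P00 HP0] := continuous_box_bounded M1 (smooth_continuous (smooth_partial 0 sX)).
  have [P1 P10 HP1] := continuous_box_bounded M1 (smooth_continuous (smooth_partial 1 sX)).
  exists (K1 + (K2 + k * ((P0 + P1) * M2))).
    by rewrite ltr_pwDl // addr_ge0 ?(ltW K20) // mulr_ge0 // mulr_ge0 ?(ltW M20) // addr_ge0 // ltW.
  move=> s sb; apply: (le_trans (ler_normB _ _)); apply: lerD; first exact: HK1.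
  apply: (le_trans (ler_normD _ _)); apply: lerD; first exact/HK2/gM1.
  rewrite normrZ ger0_norm // ler_wpM2l //.
  apply: (le_trans (jacobian_apply_le _ _ _)); apply: ler_pM.
  - by rewrite addr_ge0.
  - exact: normr_ge0.
  - by apply: lerD; [exact/HP0/gM1|exact/HP1/gM1].
  - exact: wM2.
have hK' : lipschitz_between K' 0 b (fun s => g' s - Q s).
  apply: everywhere_derive_bounded_lipschitz; first exact: ltW.
  move=> s sb; exists (X (g' s) - (X (g s) + k *: jacobian_apply X (g s) (w s))).
    exact: HK'.
  exact: hd.
have -> : g' b - g b - k *: w b = g' b - Q b by rewrite /Q opprD addrA.
have start' : `|g' 0 - Q 0| <= A * k ^+ 2 by rewrite /Q opprD addrA.
have bound : (`|g' 0 - Q 0| + K * M2 ^+ 2 * k ^+ 2 * (b - 0)) * expR (L * (b - 0)) <= C * k ^+ 2.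
  rewrite subr0 /C [leRHS]mulrAC; apply: ler_wpM2r; first exact: expR_ge0.
  by rewrite mulrDl; apply: lerD => //; rewrite [leLHS]mulrAC.
apply: (le_trans _ bound).
apply: (@trapped_gronwall R set0 K' L _ (1 / 2) 0 b (fun s => `|g' s - Q s|)) => //.
- exact: ltW.
- by rewrite mulr_ge0 ?sqr_ge0 // ltW.
- exact: lipschitz_between_norm.
- exact: negligible_set0.
- move=> s /andP[s0 sb] _ small; have sb' : 0 <= s <= b by rewrite !ltW.
  apply: has_deriv_norm_dini (hd s sb') _.
  have Qs := QM s sb'; have gs : `|g s| <= M1 + 1 by rewrite (le_trans (gM1 s sb')) // lerDl.
  have Qs1 : `|Q s| <= M1 + 1 by apply: (le_trans Qs); rewrite lerD2l; lra.
  have g's : `|g' s| <= M1 + 1.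
    have -> : g' s = (g' s - Q s) + Q s by rewrite subrK.
    apply: (le_trans (ler_normD _ _)); lra.
  have -> : X (g' s) - (X (g s) + k *: jacobian_apply X (g s) (w s)) =
     (X (g' s) - X (Q s)) + (X (Q s) - X (g s) - jacobian_apply X (g s) (Q s - g s)).
    have -> : Q s - g s = k *: w s by rewrite /Q addrC addKr.
    by rewrite jacobian_applyZ opprD [X (Q s) - _ - _]addrAC -!addrA addKr addrA;
       rewrite [- X (g s) + _]addrC addrA.
  apply: (le_trans (ler_normD _ _)); apply: lerD; first exact: HL.
  apply: (le_trans (HK _ _ gs Qs1)); rewrite -mulrA ler_pM2l //.
  have -> : Q s - g s = k *: w s by rewrite /Q addrC addKr.
  rewrite normrZ exprMn [leRHS]mulrC; apply: ler_pM; rewrite ?sqr_ge0 //.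
    by rewrite real_normK ?num_real.
  by rewrite ler_pXn2r // ?nnegrE // ?wM2 // ltW.
by apply: (le_lt_trans bound).
Qed.
End moving_frame.

(** * The set swept by two flows *)

Section confinement.
Context {R : realType}.
Local Notation mu := (@lebesgue_measure R).
Local Notation plane := 'rV[R]_2.
Implicit Types (X Y : plane -> plane) (g : R -> plane) (x y v w : plane).

Lemma forward_orbit_deriv X g t : forward_orbit X g -> 0 <= t -> has_deriv g t (X (g t)).
Proof. by move=> [a a0 H] t0; apply: H; exact: lt_le_trans t0. Qed.

Lemma tangent_increment (x1 x2 xb wb Xg Xx : plane) (h b k : R) :
  x2 - xb - (h * b *: Xx + k *: wb) =
  (x2 - x1 - (h * b) *: Xg) + (x1 - xb - k *: wb) + (h * b) *: (Xg - Xx).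
Proof.
rewrite scalerBr; move: ((h * b) *: Xg) ((h * b) *: Xx) (k *: wb) => P Q W.
apply/rowP => i; rewrite !mxE; ring.
Qed.

Section rectangle.
Variables (X Y : plane -> plane) (Phi : plane -> R -> plane) (psi : R -> plane) (M : R).
Hypotheses (sX : smooth X) (sY : smooth Y)
  (oPhi : forall z, forward_orbit X (Phi z)) (Phi0 : forall z, Phi z 0 = z)
  (opsi : forward_orbit Y psi)
  (PhiM : forall a b, 0 <= a -> 0 <= b -> `|Phi (psi a) b| <= M).

Let psiM a : 0 <= a -> `|psi a| <= M.
Proof. by move=> a0; rewrite -[psi a]Phi0; exact: PhiM. Qed.

(** The set swept by the forward [X]-orbits of the [Y]-orbit [psi] is tangent to
every admissible velocity.  Increasing [b] moves [x] along [X]; increasing [a]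
moves it along the transported field [w], and [w] is [Y] up to a multiple of [X]
and a positive factor, by [transported_field]. *)
Lemma rectangle_tangent (a b u : R) : 0 <= a -> 0 <= b -> 0 <= u <= 1 ->
  (forall s, 0 <= s <= b -> wedge (X (Phi (psi a) s)) (Y (Phi (psi a) s)) != 0) ->
  let x := Phi (psi a) b in
  exists al be, [/\ 0 <= al, b = 0 -> 0 <= be & forall e, 0 < e ->
    exists2 k, 0 < k & forall h, 0 <= h <= k -> 0 <= b + h * be ->
      `|Phi (psi (a + h * al)) (b + h * be) - x - h *: (u *: X x + (1 - u) *: Y x)| <= e * h].
Proof.
move=> a0 b0 /andP[u0 u1] Hw x.
have [Lx Lx0 HLx] := smooth_lipschitz M sX.
have [Sx Sx0 HSx] := continuous_box_bounded M (smooth_continuous sX).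
have [Ly Ly0 HLy] := smooth_lipschitz M sY.
have [Sy Sy0 HSy] := continuous_box_bounded M (smooth_continuous sY).
pose g := Phi (psi a).
have dg s : 0 <= s <= b -> has_deriv g s (X (g s)).
  by move=> /andP[s0 _]; exact: forward_orbit_deriv (oPhi _) s0.
have [w [m [nu [w0 wb nu0 m0 dw]]]] := transported_field sX sY b0 dg Hw.
pose A := Ly * Sy; have A0 : 0 <= A by rewrite mulr_ge0 // ltW.
have [C [k0 [C0 k00 HC]]] := flow_first_order sX b0 A0 dg dw.
(* Solving [u X + (1 - u) Y = be X + al w] at [x], with [w = m X + nu Y]. *)
pose al := (1 - u) / nu; pose be := u - al * m.
have al0 : 0 <= al by rewrite divr_ge0 ?subr_ge0 // ltW.
exists al, be; split => //.
  by move=> /m0 mE; rewrite /be mE mulr0 subr0.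
move=> e e0; pose W := `|w b|.
have W0 : 0 <= W by exact: normr_ge0.
pose CT := Lx * Sx * be ^+ 2 + C * al ^+ 2 + `|be| * (Lx * (al * W + C * al ^+ 2)).
have be0 : 0 <= `|be| by exact: normr_ge0.
have CT1 : 0 <= Lx * Sx * be ^+ 2.
  by apply: mulr_ge0; [exact: mulr_ge0 (ltW Lx0) (ltW Sx0) | exact: sqr_ge0].
have CT2 : 0 <= C * al ^+ 2 by apply: mulr_ge0 => //; exact: sqr_ge0.
have CT3 : 0 <= `|be| * (Lx * (al * W + C * al ^+ 2)).
  apply: mulr_ge0 => //; apply: mulr_ge0 (ltW Lx0) _.
  by apply: addr_ge0 => //; exact: mulr_ge0.
have CT0 : 0 <= CT by rewrite !addr_ge0.
have al1 : 0 < al + 1 by rewrite ltr_wpDl.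
have CTp : 0 < CT + 1 by rewrite ltr_wpDl.
exists (Num.min 1 (Num.min (k0 / (al + 1)) (e / (CT + 1)))).
  by rewrite !lt_min ltr01 !divr_gt0.
move=> h /andP[h0]; rewrite !le_min => /andP[h1 /andP[hk he]] bh0.
pose k := h * al; have k_ge0 : 0 <= k by rewrite mulr_ge0.
have kk0 : k <= k0.
  apply: (@le_trans _ _ (h * (al + 1))); first by rewrite ler_wpM2l // lerDl.
  by rewrite -ler_pdivlMr.
pose g' := Phi (psi (a + k)).
have dg' s : 0 <= s -> has_deriv g' s (X (g' s)).
  by move=> s0; exact: (forward_orbit_deriv (oPhi _) s0).
have start : `|g' 0 - g 0 - k *: w 0| <= A * k ^+ 2.
  rewrite /g' /g !Phi0 w0 /g Phi0.
  have := @orbit_second_order R Y psi M Ly Sy 0 (a + k) HLy HSy (ltW Ly0) (ltW Sy0).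
  move=> /(_ _ a (a + k)); rewrite [a + k - a]addrC addKr; apply.
  - by move=> t /andP[t0 _]; split; [exact: (forward_orbit_deriv opsi t0)|exact: psiM].
  - by rewrite a0 lerDl.
  - by rewrite addr_ge0 //= lexx.
have first : `|g' b - x - k *: w b| <= C * k ^+ 2.
  apply: HC => //; first by rewrite k_ge0.
  by move=> s /andP[s0 _]; exact: dg'.
have second : `|g' (b + h * be) - g' b - (h * be) *: X (g' b)| <= Lx * Sx * (h * be) ^+ 2.
  have := @orbit_second_order R X g' M Lx Sx 0 (b + `|h * be|) HLx HSx (ltW Lx0) (ltW Sx0).
  move=> /(_ _ b (b + h * be)); rewrite [b + h * be - b]addrC addKr; apply.
  - by move=> t /andP[t0 _]; split; [exact: dg'|apply: PhiM => //; exact: addr_ge0].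
  - by rewrite b0 lerDl normr_ge0.
  - by rewrite bh0 lerD2l ler_norm.
have g'b : `|g' b| <= M by apply: PhiM => //; exact: addr_ge0.
have xM : `|x| <= M by exact: PhiM.
have third : `|X (g' b) - X x| <= Lx * (k * W + C * k ^+ 2).
  apply: (le_trans (HLx _ _ g'b xM)); rewrite ler_pM2l //.
  have -> : g' b - x = k *: w b + (g' b - x - k *: w b) by rewrite [RHS]addrC subrK.
  by apply: (le_trans (ler_normD _ _)); apply: lerD => //; rewrite normrZ ger0_norm.
have hv : h *: (u *: X x + (1 - u) *: Y x) = (h * be) *: X x + k *: w b.
  rewrite wb !scalerDr !scalerA addrA -scalerDl.
  congr (_ *: _ + _ *: _).
    by rewrite /be /k; ring.
  by rewrite /k /al mulrA divfK // gt_eqF.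
rewrite hv.
have -> : g' (b + h * be) - x - ((h * be) *: X x + k *: w b) =
   (g' (b + h * be) - g' b - (h * be) *: X (g' b)) + (g' b - x - k *: w b) +
   (h * be) *: (X (g' b) - X x).
  exact: tangent_increment.
have hh : h ^+ 2 <= h by rewrite expr2 -[leRHS]mul1r ler_wpM2r.
apply: (@le_trans _ _ (CT * h ^+ 2)); last first.
  rewrite expr2 mulrA ler_wpM2r //; apply: (@le_trans _ _ (h * (CT + 1))).
    by rewrite mulrC ler_wpM2l // lerDl.
  by rewrite -ler_pdivlMr.
apply: (le_trans (ler_normD _ _)); rewrite /CT [leRHS]mulrDl; apply: lerD.
  apply: (le_trans (ler_normD _ _)); rewrite [leRHS]mulrDl; apply: lerD.
    suff <- : Lx * Sx * (h * be) ^+ 2 = Lx * Sx * be ^+ 2 * h ^+ 2 by [].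
    by ring.
  suff <- : C * k ^+ 2 = C * al ^+ 2 * h ^+ 2 by [].
  by rewrite /k; ring.
rewrite normrZ normrM (ger0_norm h0).
apply: (@le_trans _ _ (h * `|be| * (Lx * (h * (al * W + C * al ^+ 2))))).
  apply: ler_wpM2l; first by rewrite mulr_ge0.
  apply: (le_trans third); rewrite ler_pM2l // mulrDr; apply: lerD.
    by have -> : h * (al * W) = k * W by rewrite mulrA.
  have -> : C * k ^+ 2 = C * al ^+ 2 * h ^+ 2 by rewrite /k; ring.
  by rewrite [leRHS]mulrC; apply: ler_wpM2l.
have -> : h * `|be| * (Lx * (h * (al * W + C * al ^+ 2))) =
  `|be| * (Lx * (al * W + C * al ^+ 2)) * h ^+ 2 by rewrite expr2; ring.
exact: lexx.
Qed.
End rectangle.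
End confinement.

Section core.
Context {R : realType}.
Local Notation mu := (@lebesgue_measure R).
Local Notation plane := 'rV[R]_2.
Implicit Types (X Y : plane -> plane) (g : R -> plane) (x y v w : plane).

Lemma last_time_below (f : R -> R) (K rho t1 : R) : 0 <= t1 -> lipschitz_between K 0 t1 f ->
  f 0 <= rho -> exists t0, [/\ 0 <= t0, t0 <= t1, f t0 <= rho &
    forall t, t0 < t -> t <= t1 -> rho < f t].
Proof.
move=> t10 fK f0; pose S := [set t | 0 <= t <= t1 /\ f t <= rho].
have S0 : S 0 by split; rewrite ?lexx.
have supS : has_sup S by split; [exists 0 | exists t1 => x [/andP[]]].
have s0 : 0 <= sup S by apply: ub_le_sup => //; case: supS.
have s1 : sup S <= t1 by apply: ge_sup; [exists 0 | move=> x [/andP[]]].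
exists (sup S); split => //.
  apply/ler_addgt0Pr => e e0.
  have K1 : 0 < `|K| + 1 by rewrite ltr_wpDl.
  have [t St tS] := sup_adherent (eps := e / (`|K| + 1)) ltac:(by rewrite divr_gt0) supS.
  have [/andP[t0 tt1] ft] := St.
  have tsup : t <= sup S by apply: ub_le_sup => //; case: supS.
  have := le_trans (ler_norm _) (fK t (sup S) t0 tsup s1).
  have : K * (sup S - t) <= e.
    apply: (@le_trans _ _ ((`|K| + 1) * (sup S - t))).
      by rewrite ler_wpM2r ?subr_ge0 // (le_trans (ler_norm K)) // lerDl.
    by rewrite mulrC -ler_pdivlMr //; lra.
  lra.
move=> t St tt1; rewrite ltNge; apply/negP => ft.
have : t <= sup S.
  apply: ub_le_sup; first by case: supS.
  by split => //; rewrite tt1 andbT (le_trans s0 (ltW St)).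
by rewrite leNgt St.
Qed.

Lemma orbit_dependence X (M L b : R) (g1 g2 : R -> plane) : 0 <= b -> 0 <= L ->
  (forall x y, `|x| <= M -> `|y| <= M -> `|X x - X y| <= L * `|x - y|) ->
  forall S, (forall x, `|x| <= M -> `|X x| <= S) -> 0 <= S ->
  (forall t, 0 <= t -> has_deriv g1 t (X (g1 t)) /\ `|g1 t| <= M) ->
  (forall t, 0 <= t -> has_deriv g2 t (X (g2 t)) /\ `|g2 t| <= M) ->
  `|g1 b - g2 b| <= `|g1 0 - g2 0| * expR (L * b).
Proof.
move=> b0 L0 HL S HS S0 H1 H2.
have hd t : 0 <= t -> has_deriv (fun s => g1 s - g2 s) t (X (g1 t) - X (g2 t)).
  by move=> t0; apply: has_derivB; [case: (H1 t t0)|case: (H2 t t0)].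
have hK : lipschitz_between (S + S) 0 b (fun s => g1 s - g2 s).
  apply: everywhere_derive_bounded_lipschitz; first exact: addr_ge0.
  move=> t /andP[t0 _]; exists (X (g1 t) - X (g2 t)); last exact: hd.
  apply: (le_trans (ler_normB _ _)).
  by apply: lerD; apply: HS; [case: (H1 t t0)|case: (H2 t t0)].
have := @gronwall R set0 _ L 0 0 b _ _ b0 L0 (lexx 0) hK (negligible_set0 _).
rewrite mul0r addr0 subr0; apply => t /andP[t0 tb] _.
exists (X (g1 t) - X (g2 t)); last exact/hd/ltW.
by rewrite addr0; apply: HL; [case: (H1 t (ltW t0))|case: (H2 t (ltW t0))].
Qed.

(** A nearest point exists because the forward [X]-flow of a [Y]-arc, over
bounded times, is the continuous image of a rectangle. *)
Lemma nearest_in_rectangle X Y (Phi : plane -> R -> plane) (psi : R -> plane) (M A B : R) :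
  smooth X -> smooth Y -> 0 <= A -> 0 <= B ->
  (forall z, forward_orbit X (Phi z)) -> (forall z, Phi z 0 = z) -> forward_orbit Y psi ->
  (forall a b, 0 <= a -> 0 <= b -> `|Phi (psi a) b| <= M) ->
  forall y, exists q : R * R, [/\ 0 <= q.1 <= A, 0 <= q.2 <= B &
    forall a b, 0 <= a <= A -> 0 <= b <= B ->
      `|y - Phi (psi q.1) q.2| <= `|y - Phi (psi a) b|].
Proof.
move=> sX sY A0 B0 oPhi Phi0 opsi PhiM y.
have psiM a : 0 <= a -> `|psi a| <= M by move=> a0; rewrite -[psi a]Phi0; exact: PhiM.
have [Lx Lx0 HLx] := smooth_lipschitz M sX.
have [Sx Sx0 HSx] := continuous_box_bounded M (smooth_continuous sX).
have [Sy Sy0 HSy] := continuous_box_bounded M (smooth_continuous sY).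
pose E := expR (Lx * B); have E0 : 0 < E by exact: expR_gt0.
have lip (T : R) (h : R -> plane) (Z : plane -> plane) (S : R) : forward_orbit Z h ->
    0 < S -> (forall t, 0 <= t -> `|h t| <= M) -> (forall x, `|x| <= M -> `|Z x| <= S) ->
    forall s t, 0 <= s <= T -> 0 <= t <= T -> `|h t - h s| <= S * `|t - s|.
  move=> oh S0 hM HS s t /andP[s0 sT] /andP[t0 tT].
  have hL : lipschitz_between S 0 T h.
    apply: everywhere_derive_bounded_lipschitz; first exact: ltW.
    move=> r /andP[r0 _]; exists (Z (h r)); first exact/HS/hM.
    exact: (forward_orbit_deriv oh r0).
  have [st|ts] := leP s t; first by rewrite ger0_norm ?subr_ge0 //; exact: hL.
  rewrite distrC (distrC t) ger0_norm ?subr_ge0 ?(ltW ts) //; apply: hL => //; exact: ltW.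
pose cl : R -> R -> R := @segment_retract R.
pose T (q : R * R) := Phi (psi (cl A q.1)) (cl B q.2).
have TL p q : `|T p - T q| <= Sx * `|cl B p.2 - cl B q.2| + E * Sy * `|cl A p.1 - cl A q.1|.
  have /andP[a0 aA] := segment_retract_itv p.1 A0.
  have /andP[a0' aA'] := segment_retract_itv q.1 A0.
  have /andP[b0 bB] := segment_retract_itv p.2 B0.
  have /andP[b0' bB'] := segment_retract_itv q.2 B0.
  have -> : T p - T q = (Phi (psi (cl A p.1)) (cl B p.2) - Phi (psi (cl A p.1)) (cl B q.2)) +
     (Phi (psi (cl A p.1)) (cl B q.2) - T q) by rewrite addrA subrK.
  apply: (le_trans (ler_normD _ _)); apply: lerD.
    apply: (lip B _ X) => //; rewrite ?b0 ?b0' //.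
    by move=> t t0; exact: PhiM.
  apply: (le_trans (@orbit_dependence X M Lx (cl B q.2) (Phi (psi (cl A p.1)))
    (Phi (psi (cl A q.1))) b0' (ltW Lx0) HLx Sx HSx (ltW Sx0) _ _)).
  - by move=> t t0; split; [exact: (forward_orbit_deriv (oPhi _) t0)|exact: PhiM].
  - by move=> t t0; split; [exact: (forward_orbit_deriv (oPhi _) t0)|exact: PhiM].
  rewrite !Phi0 -[leRHS]mulrA [leRHS]mulrC; apply: ler_pM.
  - exact: normr_ge0.
  - exact: expR_ge0.
  - by apply: (lip A _ Y) => //; rewrite ?a0 ?a0'.
  - by rewrite ler_expR ler_pM2l.
have cT : continuous (fun q => `|y - T q|).
  move=> p; apply/cvgrPdist_lt => e e0.
  pose c := Sx + E * Sy + 1.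
  have c0 : 0 < c by rewrite !addr_gt0 // mulr_gt0.
  have near2 : \forall q \near p, `|cl B p.2 - cl B q.2| < e / c.
    have h : {for p, continuous (fun q : R * R => cl B q.2)}.
      exact: (@continuous_comp _ _ _ (@snd R R) (cl B) p cvg_snd (@segment_retract_continuous R B p.2)).
    by move/cvgrPdist_lt : h; apply; rewrite divr_gt0.
  have near1 : \forall q \near p, `|cl A p.1 - cl A q.1| < e / c.
    have h : {for p, continuous (fun q : R * R => cl A q.1)}.
      exact: (@continuous_comp _ _ _ (@fst R R) (cl A) p cvg_fst (@segment_retract_continuous R A p.1)).
    by move/cvgrPdist_lt : h; apply; rewrite divr_gt0.
  move: near1 near2; apply: filterS2 => q h1 h2.
  have h3 : `|T p - T q| < e.
    apply: (le_lt_trans (TL p q)); rewrite -[ltRHS](divfK (x := c)) ?gt_eqF //.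
    have k1 : Sx * `|cl B p.2 - cl B q.2| <= Sx * (e / c) by rewrite ler_pM2l // ltW.
    have k2 : E * Sy * `|cl A p.1 - cl A q.1| <= E * Sy * (e / c).
      by rewrite ler_pM2l ?mulr_gt0 // ltW.
    have : 0 < e / c by rewrite divr_gt0.
    rewrite {3}/c; move: k1 k2; set d := e / c; nra.
  apply: le_lt_trans h3; rewrite ler_norml.
  have := lerB_dist (y - T p) (y - T q); have := lerB_dist (y - T q) (y - T p).
  have e1 : (y - T q) - (y - T p) = T p - T q by rewrite [- (y - T p)]opprB [LHS]addrC addrA subrK.
  have e2 : (y - T p) - (y - T q) = - (T p - T q) by rewrite -e1 [RHS]opprB.
  by rewrite e1 e2 normrN; lra.
have cR : compact (`[0, A]%classic `*` `[0, B]%classic : set (R * R)).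
  by apply: compact_setX; exact: segment_compact.
have ne : (`[0, A]%classic `*` `[0, B]%classic : set (R * R)) !=set0.
  by exists (0, 0); split; rewrite /= in_itv /= lexx.
have [q] := compact_EVT_min ne cR (continuous_subspaceT cT).
rewrite inE => -[] /=; rewrite !in_itv /= => q1 q2 Hq.
exists q; split => // a b aA bB.
have := Hq (a, b); rewrite /T /cl /= !segment_retract_id //; apply.
by rewrite inE; split; rewrite /= in_itv.
Qed.

(** Leaving the ball of radius [rho] for the last time at [t0], the trajectory
remains in the set swept by the forward [X]-orbits of the forward [Y]-orbit of
its position at time [t0]: its distance to this set vanishes at [t0] and grows
at most like [L] times itself, since the set is tangent to the velocities and
the fields are Lipschitz.  The equation is required only while [g] is in the
ball of radius [M + 1], so that the statement also covers solutions of truncated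
systems. *)
Theorem confinement X Y (r rho0 : R) : smooth X -> smooth Y ->
  globally_asymptotically_stable X -> globally_asymptotically_stable Y ->
  0 < r -> (forall x, r < `|x| -> wedge (X x) (Y x) != 0) ->
  exists2 M, 0 < M & forall (g : R -> plane) (t1 K : R) (N : set R),
    0 <= t1 -> lipschitz_between K 0 t1 g -> `|g 0| <= rho0 -> mu.-negligible N ->
    (forall t, 0 < t < t1 -> ~ N t -> `|g t| <= M + 1 ->
      exists2 u : R, 0 <= u <= 1 & has_deriv g t (u *: X (g t) + (1 - u) *: Y (g t))) ->
    `|g t1| <= M.
Proof.
move=> sX sY gasX gasY r0 Hwedge.
have [rho' rho'0 U1] := uniform_attraction sX gasX r r0.
(* [X]-orbits issued from the ball of radius [r] stay within [rho'], so a point of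
   the swept set of norm larger than [rho'] is reached without meeting that ball. *)
pose rho := Num.max rho0 (rho' + 1).
have [rho1 rho10 U2] := uniform_attraction sY gasY rho r0.
have [rho2 rho20 U3] := uniform_attraction sX gasX rho1 r0.
pose M := Num.max rho rho2.
exists M; first by rewrite lt_max rho20 orbT.
move=> g t1 K N t10 gK g0 N0 Hg.
have gK' := lipschitz_between_norm gK.
have g0' : `|g 0| <= rho by rewrite le_max g0.
have [t0 [t00 t01 gt0 after]] := last_time_below t10 gK' g0'.
have [gt1|gt1] := leP `|g t1| rho; first by rewrite le_max gt1.
have [psi [opsi psi0 _]] := forward_orbit_exists sY gasY (g t0).
have /choice[Phi PhiP] : forall z, exists f, forward_orbit X f /\ f 0 = z.
  by move=> z; have [f [of_ f0 _]] := forward_orbit_exists sX gasX z; exists f.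
have oPhi z : forward_orbit X (Phi z) by case: (PhiP z).
have Phi0 z : Phi z 0 = z by case: (PhiP z).
have psi_bd a : 0 <= a -> `|psi a| <= rho1 /\ (rho1 <= a -> `|psi a| <= r).
  by apply: U2 => //; rewrite psi0.
have Phi_bd a b : 0 <= a -> 0 <= b ->
    `|Phi (psi a) b| <= rho2 /\ (rho2 <= b -> `|Phi (psi a) b| <= r).
  by move=> a0; apply: U3 => //; rewrite Phi0; case: (psi_bd a a0).
have PhiM a b : 0 <= a -> 0 <= b -> `|Phi (psi a) b| <= rho2.
  by move=> a0 b0; case: (Phi_bd a b a0 b0).
have trap f t : forward_orbit X f -> `|f 0| <= r -> 0 <= t -> `|f t| <= rho'.
  by move=> of_ f0 t_0; case: (U1 f of_ f0 t t_0).
have /choice[Q QP] :=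
  nearest_in_rectangle sX sY (ltW rho10) (ltW rho20) oPhi Phi0 opsi PhiM.
pose T y := Phi (psi (Q y).1) (Q y).2.
pose dist y := `|y - T y|.
have distL y z : dist y <= `|y - z| + dist z.
  have [q1 q2 _] := QP z; have [_ _ /(_ _ _ q1 q2) h] := QP y.
  apply: (le_trans h); rewrite -/(T z) /dist.
  have -> : y - T z = (y - z) + (z - T z) by rewrite addrA subrK.
  exact: ler_normD.
have [L1 L10 HL1] := smooth_lipschitz (M + 1) sX.
have [L2 L20 HL2] := smooth_lipschitz (M + 1) sY.
pose L := Num.max L1 L2; have L0 : 0 < L by rewrite lt_max L10.
have dist0 : dist (g t0) = 0.
  apply/le_anti; rewrite normr_ge0 andbT.
  have [_ _ /(_ 0 0)] := QP (g t0); rewrite Phi0 psi0 subrr normr0; apply.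
    by rewrite lexx ltW.
  by rewrite lexx ltW.
have distK : lipschitz_between K t0 t1 (fun t => dist (g t)).
  move=> s t t0s st tt1; have h := gK s t (le_trans t00 t0s) st tt1.
  rewrite ler_norml; have := distL (g s) (g t); have := distL (g t) (g s).
  by rewrite (distrC (g s)); move: h; set d := `|g t - g s|; lra.
have dini t : t0 < t < t1 -> ~ (N t) -> dist (g t) < 1 ->
    right_dini_le (fun t => dist (g t)) t (L * dist (g t) + 0).
  move=> /andP[t0t tt1] nN small; rewrite addr0.
  have [] := QP (g t); case E : (Q (g t)) => [a b] /= /andP[a0 aA] /andP[b0 bB] _.
  pose x := Phi (psi a) b.
  have Tx : T (g t) = x by rewrite /T E.
  have xM : `|x| <= rho2 by exact: PhiM.
  have dx : dist (g t) = `|g t - x| by rewrite /dist Tx.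
  have gx : `|g t| <= dist (g t) + `|x|.
    by rewrite dx -{1}[g t](subrK x); exact: ler_normD.
  have xfar : rho' < `|x|.
    have := after t t0t (ltW tt1); have : rho' + 1 <= rho by rewrite le_max lexx orbT.
    lra.
  have away s : 0 <= s <= b -> r < `|Phi (psi a) s|.
    move=> /andP[s0 sb]; rewrite ltNge; apply/negP => h.
    have := trap _ (b - s) (forward_orbit_shift s0 (oPhi (psi a))).
    by rewrite add0r subrK subr_ge0 -/x => /(_ h sb); rewrite leNgt xfar.
  (* The nearest point is not on the far sides of the rectangle of parameters:
     they consist of points whose orbit has met the ball of radius [r]. *)
  have aA' : a < rho1.
    rewrite lt_neqAle aA andbT; apply/eqP => aE.
    have [_ /(_ _)] := psi_bd a a0; rewrite aE lexx => /(_ isT) h.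
    by have := away 0; rewrite lexx b0 Phi0 aE => /(_ isT); rewrite ltNge h.
  have bB' : b < rho2.
    rewrite lt_neqAle bB andbT; apply/eqP => bE.
    have [_ /(_ _)] := Phi_bd a b a0 b0; rewrite bE lexx => /(_ isT) h.
    by have := away b; rewrite lexx b0 bE => /(_ isT); rewrite ltNge h.
  have xM1 : `|x| <= M + 1.
    by apply: (le_trans xM); rewrite /M -[leLHS]addr0; apply: lerD => //; rewrite le_max lexx orbT.
  have gM : `|g t| <= M + 1.
    apply: (le_trans gx); rewrite addrC; apply: lerD; last exact: ltW.
    by apply: (le_trans xM); rewrite le_max lexx orbT.
  have [|u u01 gd] := Hg t _ nN gM; first by rewrite (le_lt_trans t00 t0t).
  have [al [be [al0 be0 tan]]] := rectangle_tangent sX sY oPhi Phi0 opsi PhiM a0 b0 u01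
    (fun s sb => Hwedge _ (away s sb)).
  move=> e e0; have e20 : 0 < e / 2 by rewrite divr_gt0.
  have [k k0 Hk] := tan (e / 2) e20; have [d d0 Hd] := gd (e / 2) e20.
  have [k1 k10 Hk1] : exists2 k1, 0 < k1 & forall h, 0 <= h <= k1 ->
      a + h * al <= rho1 /\ 0 <= b + h * be <= rho2.
    pose be' := `|be| + 1; have be'0 : 0 < be' by rewrite ltr_wpDl.
    have al1 : 0 < al + 1 by rewrite ltr_wpDl.
    pose k2 := Num.min ((rho1 - a) / (al + 1)) ((rho2 - b) / be').
    have k20 : 0 < k2 by rewrite lt_min !divr_gt0 // subr_gt0.
    have up h : 0 <= h -> h <= k2 -> a + h * al <= rho1 /\ b + h * be <= rho2.
      move=> h0; rewrite le_min !ler_pdivlMr // => /andP[h1 h2].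
      have : h * al <= h * (al + 1) by rewrite ler_wpM2l // lerDl.
      have : h * be <= h * be'.
        by rewrite ler_wpM2l // (le_trans (ler_norm be)) // lerDl.
      by split; lra.
    (* On the edge [b = 0] only [be >= 0] keeps the second parameter
       nonnegative. *)
    have [b_0|b_pos] := eqVneq b 0.
      exists k2 => // h /andP[h0 hk]; have [h1 h2] := up h h0 hk; split => //.
      by rewrite h2 andbT b_0 add0r mulr_ge0 // be0.
    have {}b_pos : 0 < b by rewrite lt_neqAle eq_sym b_pos.
    exists (Num.min k2 (b / be')); first by rewrite lt_min k20 divr_gt0.
    move=> h; rewrite le_min => /andP[h0 /andP[hk]]; rewrite ler_pdivlMr // => hb.
    have [h1 h2] := up h h0 hk; split => //; rewrite h2 andbT.
    have : h * - be <= h * be'.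
      by rewrite ler_wpM2l // (le_trans (ler_norm (- be))) // normrN lerDl.
    lra.
  exists (Num.min d (Num.min k k1)); first by rewrite !lt_min d0 k0.
  move=> s ts sd; pose h := s - t.
  have h0 : 0 <= h by rewrite subr_ge0.
  have : h < Num.min d (Num.min k k1) by rewrite /h; lra.
  rewrite !lt_min => /andP[hd /andP[hk hk1]].
  have [h1 /andP[h2 h3]] := Hk1 h ltac:(by rewrite h0 ltW).
  have tang := Hk h ltac:(by rewrite h0 ltW) h2.
  pose xh := Phi (psi (a + h * al)) (b + h * be).
  have ds : dist (g s) <= `|g s - xh|.
    have [_ _] := QP (g s); apply; last by rewrite h2.
    by rewrite h1 andbT addr_ge0 // mulr_ge0.
  have gs : `|g s - g t - h *: (u *: X (g t) + (1 - u) *: Y (g t))| <= e / 2 * h.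
    by have := Hd s; rewrite -/h ger0_norm //; apply.
  pose vg := u *: X (g t) + (1 - u) *: Y (g t); pose vx := u *: X x + (1 - u) *: Y x.
  have vv : `|vg - vx| <= L * dist (g t).
    have -> : vg - vx = u *: (X (g t) - X x) + (1 - u) *: (Y (g t) - Y x).
      by rewrite /vg /vx opprD addrACA -!scalerBr.
    rewrite dx; apply: convex_norm_le => //.
      by apply: (le_trans (HL1 _ _ gM xM1)); rewrite ler_wpM2r // le_max lexx.
    by apply: (le_trans (HL2 _ _ gM xM1)); rewrite ler_wpM2r // le_max lexx orbT.
  have split4 : g s - xh = (g s - g t - h *: vg) - (xh - x - h *: vx) + ((g t - x) + h *: (vg - vx)).
    rewrite scalerBr; move: (h *: vg) (h *: vx) (g s) (g t) => P1 P2 G1 G2.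
    by apply/rowP => i; rewrite !mxE; ring.
  have : `|g s - xh| <= e / 2 * h + e / 2 * h + (dist (g t) + h * (L * dist (g t))).
    rewrite split4; apply: (le_trans (ler_normD _ _)); apply: lerD.
      by apply: (le_trans (ler_normB _ _)); apply: lerD.
    apply: (le_trans (ler_normD _ _)); rewrite dx -dx; apply: lerD; first by rewrite dx.
    by rewrite normrZ ger0_norm // ler_wpM2l.
  rewrite -/h; move: ds; set D := dist (g t); set D' := dist (g s); lra.
have := @trapped_gronwall R N K L 0 1 t0 t1 (fun t => dist (g t)) t01 (ltW L0) (lexx 0) ltr01.
rewrite dist0 mul0r addr0 mul0r => /(_ _ distK N0 dini ltr01) final.
have : dist (g t1) <= 0 by apply: final => t _; exact: normr_ge0.
rewrite normr_le0 subr_eq0 => /eqP ->.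
have [/andP[a0 _] /andP[b0 _] _] := QP (g t1).
by rewrite le_max PhiM ?orbT.
Qed.
End core.

(** * Switched trajectories *)

Section switched_trajectories.
Context {R : realType}.
Local Notation mu := (@lebesgue_measure R).
Local Notation plane := 'rV[R]_2.
Implicit Types (X Y : plane -> plane) (g : R -> plane) (u : R -> R) (x y : plane).

Lemma det_plane (A : 'M[R]_2) : \det A = A 0 0 * A 1 1 - A 0 1 * A 1 0.
Proof.
rewrite (expand_det_row _ 0) !big_ord_recl big_ord0 addr0 /cofactor !det_mx11 !mxE.
have e0 : lift (0 : 'I_2) (0 : 'I_1) = 1 by exact/val_inj.
have e1 : lift (1 : 'I_2) (0 : 'I_1) = 0 by exact/val_inj.
by rewrite !e0 !e1 /= expr0 expr1 mul1r mulN1r mulrN.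
Qed.

Lemma det_wedge x y : \det (col_mx x y : 'M[R]_2) = wedge x y.
Proof.
have e0 (i : 'I_2) : (col_mx x y : 'M[R]_2) 0 i = x 0 i.
  by rewrite -(@col_mxEu R 1 1 2 x y 0 i); congr (col_mx x y _ _); exact/val_inj.
have e1 (i : 'I_2) : (col_mx x y : 'M[R]_2) 1 i = y 0 i.
  by rewrite -(@col_mxEd R 1 1 2 x y 0 i); congr (col_mx x y _ _); exact/val_inj.
by rewrite det_plane !e0 !e1.
Qed.

Lemma absolutely_continuous_bounded g (b : R) : 0 <= b ->
  absolutely_continuous_between 0 b g ->
  exists2 M, 0 < M & forall t, 0 <= t <= b -> `|g t| <= M.
Proof.
move=> b_ge0 gAC.
have uc e : 0 < e -> exists2 d, 0 < d & forall s t, 0 <= s -> s <= t -> t <= b ->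
    t - s < d -> `|g t - g s| < e.
  move=> /gAC[d d0 Hd]; exists d => // s t s0 st tb std.
  have := Hd 1%N (fun=> s) (fun=> t); rewrite !big_ord1; apply => //.
  by move=> i j _ _ _; rewrite !ord1.
pose cl := segment_retract b.
have cl0b s : 0 <= cl s <= b := segment_retract_itv s b_ge0.
have cl_le s t : s <= t -> cl s <= cl t /\ cl t - cl s <= t - s.
  exact: segment_retract_monotone.
have [t _|M M0 HM] := @segment_bounded R _ (fun t => g (cl t)) 0 b.
  apply/cvgrPdist_lt => e /uc[d d0 Hd]; exists d => // s; rewrite /ball /= => ts.
  have [st|ts'] := leP s t.
    have [h1 h2] := cl_le s t st; apply: Hd => //.
    - by case/andP: (cl0b s).
    - by case/andP: (cl0b t).
    - by apply: le_lt_trans h2 _; rewrite -(ger0_norm (x := t - s)) ?subr_ge0.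
  have [h1 h2] := cl_le t s (ltW ts'); rewrite distrC; apply: Hd => //.
  - by case/andP: (cl0b t).
  - by case/andP: (cl0b s).
  - apply: le_lt_trans h2 _; rewrite -(ger0_norm (x := s - t)) ?subr_ge0 1?ltW //.
    by rewrite distrC.
by exists M => // t tb; have := HM t tb; rewrite /cl segment_retract_id.
Qed.

Lemma compact_norm_bounded (K : set plane) : compact K ->
  exists2 M, 0 < M & forall x, K x -> `|x| <= M.
Proof.
move=> /compact_bounded[M [_ HM]]; exists (`|M| + 1); first by rewrite ltr_wpDl.
move=> x Kx; apply: (HM (`|M| + 1)) => //.
by rewrite (le_lt_trans (ler_norm M)) // ltrDl.
Qed.

(** On a compact interval both solutions are bounded, hence Lipschitz, and the
right-hand side is Lipschitz in the position uniformly in the control. *)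
Lemma switched_solution_uniqueness X Y u p (T1 T2 : \bar R) g1 g2 : smooth X -> smooth Y ->
  switching_function u -> switched_solution X Y u p T1 g1 -> switched_solution X Y u p T2 g2 ->
  forall t, 0 <= t -> (t%:E < T1)%E -> (t%:E < T2)%E -> g1 t = g2 t.
Proof.
move=> sX sY [_ u01] [T10 g10 AC1 ae1] [T20 g20 AC2 ae2] b b_ge0 bT1 bT2.
have [b_eq0|b_neq0] := eqVneq b 0; first by rewrite b_eq0 g10 g20.
have b0 : 0 < b by rewrite lt_neqAle eq_sym b_neq0.
have {}AC1 : absolutely_continuous_between 0 b g1 := AC1 b b0 bT1.
have {}AC2 : absolutely_continuous_between 0 b g2 := AC2 b b0 bT2.
have [M1 M10 HM1] := absolutely_continuous_bounded b_ge0 AC1.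
have [M2 M20 HM2] := absolutely_continuous_bounded b_ge0 AC2.
pose M := Num.max M1 M2.
have g1M t : 0 <= t <= b -> `|g1 t| <= M by move=> tb; rewrite le_max HM1.
have g2M t : 0 <= t <= b -> `|g2 t| <= M by move=> tb; rewrite le_max HM2 ?orbT.
have [SX SX0 HSX] := continuous_box_bounded M (smooth_continuous sX).
have [SY SY0 HSY] := continuous_box_bounded M (smooth_continuous sY).
have [LX LX0 HLX] := smooth_lipschitz M sX.
have [LY LY0 HLY] := smooth_lipschitz M sY.
pose F t x := u t *: X x + (1 - u t) *: Y x.
pose S := Num.max SX SY; pose L := Num.max LX LY.
have S0 : 0 <= S by rewrite le_max ltW.
have L0 : 0 <= L by rewrite le_max ltW.
have FS t x : 0 <= t -> `|x| <= M -> `|F t x| <= S.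
  move=> t0 xM; apply: convex_norm_le; first exact: u01.
    by rewrite le_max HSX.
  by rewrite le_max HSY ?orbT.
have FL t x y : 0 <= t -> `|x| <= M -> `|y| <= M -> `|F t x - F t y| <= L * `|x - y|.
  move=> t0 xM yM; rewrite /F.
  have -> : u t *: X x + (1 - u t) *: Y x - (u t *: X y + (1 - u t) *: Y y) =
    u t *: (X x - X y) + (1 - u t) *: (Y x - Y y) by rewrite opprD addrACA -!scalerBr.
  apply: convex_norm_le; first exact: u01.
    by apply: (le_trans (HLX _ _ xM yM)); rewrite ler_wpM2r // le_max lexx.
  by apply: (le_trans (HLY _ _ xM yM)); rewrite ler_wpM2r // le_max lexx orbT.
have inner (T : \bar R) t : 0 < t < b -> (b%:E < T)%E -> 0 < t /\ (t%:E < T)%E.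
  by move=> /andP[t0 tb] bT; split => //; apply: lt_trans bT; rewrite lte_fin.
pose N1 := ~` [set t : R | 0 < t -> (t%:E < T1)%E -> is_derive t (1 : R) g1 (F t (g1 t))].
pose N2 := ~` [set t : R | 0 < t -> (t%:E < T2)%E -> is_derive t (1 : R) g2 (F t (g2 t))].
have N10 : mu.-negligible N1 by exact: ae1.
have N20 : mu.-negligible N2 by exact: ae2.
have d1 t : 0 < t < b -> ~ N1 t -> has_deriv g1 t (F t (g1 t)).
  move=> tb /contrapT /= H; have [h1 h2] := inner T1 t tb bT1.
  exact/is_deriveP/H.
have d2 t : 0 < t < b -> ~ N2 t -> has_deriv g2 t (F t (g2 t)).
  move=> tb /contrapT /= H; have [h1 h2] := inner T2 t tb bT2.
  exact/is_deriveP/H.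
have closed t : 0 < t < b -> 0 <= t <= b by move=> /andP[t0 tb]; rewrite !ltW.
have pos t : 0 < t < b -> 0 <= t by move=> /andP[t0 _]; exact: ltW.
have lip1 : lipschitz_between S 0 b g1.
  apply: (ae_derive_bounded_lipschitz S0 AC1 N10) => t tb nN.
  by exists (F t (g1 t)); [apply: FS; [exact: pos tb|exact/g1M/closed]|exact: d1].
have lip2 : lipschitz_between S 0 b g2.
  apply: (ae_derive_bounded_lipschitz S0 AC2 N20) => t tb nN.
  by exists (F t (g2 t)); [apply: FS; [exact: pos tb|exact/g2M/closed]|exact: d2].
have lip : lipschitz_between (S + S) 0 b (fun t => g1 t - g2 t).
  move=> s t s0 st tb.
  have -> : g1 t - g2 t - (g1 s - g2 s) = (g1 t - g1 s) - (g2 t - g2 s).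
    by rewrite !opprB addrACA [RHS]addrACA; congr (_ + _); rewrite addrC.
  apply: (le_trans (ler_normB _ _)); rewrite mulrDl.
  by apply: lerD; [exact: lip1|exact: lip2].
have N120 : mu.-negligible (N1 `|` N2) by exact: negligibleU.
have := gronwall (h := fun t => g1 t - g2 t) b_ge0 L0 (lexx 0) lip N120.
rewrite g10 g20 subrr normr0 mul0r addr0 mul0r => H.
apply/eqP; rewrite -subr_eq0 -normr_le0; apply: H => t tb /not_orP[n1 n2].
exists (F t (g1 t) - F t (g2 t)); last by apply: has_derivB; [exact: d1|exact: d2].
by rewrite addr0; apply: FL; [exact: pos tb|exact/g1M/closed|exact/g2M/closed].
Qed.

(** Solving the system truncated outside the ball of radius [M + 1] gives a
solution for all times; the confinement hypothesis keeps it in the ball of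
radius [M], where the truncation has no effect. *)
Lemma confined_solution_exists X Y u p (M : R) : smooth X -> smooth Y -> 0 < M ->
  (forall (g : R -> plane) (t1 K : R) (N : set R),
    0 <= t1 -> lipschitz_between K 0 t1 g -> g 0 = p -> mu.-negligible N ->
    (forall t, 0 < t < t1 -> ~ N t -> `|g t| <= M + 1 ->
      exists2 u : R, 0 <= u <= 1 & has_deriv g t (u *: X (g t) + (1 - u) *: Y (g t))) ->
    `|g t1| <= M) ->
  switching_function u ->
  exists2 g, switched_solution X Y u p +oo%E g & forall t, 0 <= t -> `|g t| <= M.
Proof.
move=> sX sY M0 conf su; have [v [mv v01] [N1 N10 vu]] := borel_control su.
have M10 : 0 <= M + 1 by rewrite addr_ge0 // ltW.
have [LX [KX [LX0 KX0 HLX HKX]]] := truncation_lipschitz M10 sX.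
have [LY [KY [LY0 KY0 HLY HKY]]] := truncation_lipschitz M10 sY.
pose A x := X (clamp (M + 1) x); pose B x := Y (clamp (M + 1) x).
pose L := Num.max LX LY; pose K := Num.max KX KY.
have L0 : 0 < L by rewrite lt_max LX0.
have AL x y : `|A x - A y| <= L * `|x - y|.
  by apply: (le_trans (HLX x y)); rewrite ler_wpM2r // le_max lexx.
have BL x y : `|B x - B y| <= L * `|x - y|.
  by apply: (le_trans (HLY x y)); rewrite ler_wpM2r // le_max lexx orbT.
have AK x : `|A x| <= K by rewrite le_max HKX.
have BK x : `|B x| <= K by rewrite le_max HKY orbT.
have [q [q0 qK [N2 N20 qd]]] := @caratheodory_existence R A B L K v p L0 AL AK BL BK mv v01.
have N0 : mu.-negligible (N1 `|` N2) by exact: negligibleU.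
have dq t : 0 < t -> ~ (N1 `|` N2) t -> `|q t| <= M + 1 ->
    has_deriv q t (u t *: X (q t) + (1 - u t) *: Y (q t)).
  move=> t0 /not_orP[n1 n2] qM; have t1 : -1 < t by lra.
  by have := qd t t1 n2; rewrite /A /B !clamp_id // vu // ltW.
have [_ u01] := su.
have qM t1 : 0 <= t1 -> `|q t1| <= M.
  move=> t10; apply: (conf q t1 K _ t10 (qK 0 t1) q0 N0) => t /andP[t0 _] nN qM.
  by exists (u t); [exact/u01/ltW|exact: dq].
exists q => //; split => //.
  by move=> b b0 _; exact: lipschitz_absolutely_continuous (qK 0 b).
apply: negligibleS N0 => t /= H; apply: contrapT => nN; apply: H => t0 _.
by apply/is_deriveP/dq => //; apply: (le_trans (qM t (ltW t0))); rewrite lerDl.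
Qed.
End switched_trajectories.

Theorem theorem8 (R : realType) (X Y : 'rV[R]_2 -> 'rV[R]_2)
  (smoothX : smooth X) (smoothY : smooth Y)
  (X0 : X 0 = 0) (Y0 : Y 0 = 0)
  (gasX : globally_asymptotically_stable X)
  (gasY : globally_asymptotically_stable Y)
  (compactZ : compact (collinearity_set X Y)) :
  bounded_switched_system X Y.
Proof.
move=> K1 /compact_norm_bounded[rho0 _ K1rho].
have [r r0 Zr] := compact_norm_bounded compactZ.
have away x : r < `|x| -> wedge (X x) (Y x) != 0.
  move=> rx; apply/eqP => wx; move: rx; rewrite ltNge Zr //.
  by rewrite /collinearity_set /= det_wedge.
have [M M0 conf] := confinement rho0 smoothX smoothY gasX gasY r0 away.
exists [set x | `|x| <= M]; first exact: box_compact.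
move=> u su p Kp.
have [|q qs qM] := @confined_solution_exists R X Y u p M smoothX smoothY M0 _ su.
  by move=> g t1 K N t10 gK g0; apply: conf t10 gK _; rewrite g0; exact: K1rho.
split; first by exists +oo%E, q; split => // T g' T_oo _ _; apply/eqP; rewrite -leye_eq.
move=> T g [gs gmax].
have gq t : 0 <= t -> (t%:E < T)%E -> g t = q t.
  by move=> t0 tT; apply: (switched_solution_uniqueness smoothX smoothY su gs qs) => //; rewrite ltry.
have T_oo : T = +oo%E.
  by apply/esym/(gmax +oo%E q) => //; [rewrite leey|move=> t t0 tT; rewrite gq].
by split => // t t0 /=; rewrite gq // ?T_oo ?ltry //; exact: qM.
Qed.
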